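(* Let $(e_k)_{k\ge1}$ be a sequence of real numbers satisfying the Weyl growth condition: there exist $\epsilon>0$ and $\delta>0$ such that $|e_n-e_m|>\delta$ for all indices $n,m$ with $|n-m|>n/(\log n)^{1+\epsilon}$. For $n\ge1$ and $t\in\mathbb R$ let $r_n(t)=\prod_{k=1}^n\cos(e_k t)$. Then for Lebesgue-almost every $t\in\mathbb R$, $$\lim_{n\to\infty}\frac1n\log|r_n(t)|=-\log 2.$$
   Context: $r_n(t)$ is the decoherence factor of the spin bath model with $n$ environment spins and coupling constants $e_1,\dots,e_n$. *)

(* Defs.v *)
From mathcomp Require Import all_boot all_order all_algebra.
From mathcomp Require Import all_classical all_reals all_analysis.
Set Implicit Arguments. Unset Strict Implicit. Unset Printing Implicit Defensive.
Import Order.TTheory GRing.Theory Num.Theory.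
Local Open Scope ring_scope.

(* Decoherence factor r_n(t) = prod_{k=1}^n cos(e_k t); the sequence e is
   indexed from 1 (e 0 is ignored). *)
Definition decoherence (R : realType) (e : nat -> R) (n : nat) (t : R) : R :=
  \prod_(1 <= k < n.+1) cos (e k * t).

(* Weyl growth condition: exists eps > 0, delta > 0 such that
   |e_n - e_m| > delta whenever |n - m| > n / (log n)^(1+eps).
   Indices range over n, m >= 1; for n = 1 the bound n/(log n)^(1+eps)
   is +infinity (log 1 = 0), so the condition is vacuous there and we
   quantify over n >= 2. *)
Definition weyl_growth (R : realType) (e : nat -> R) : Prop :=
  exists eps : R, exists delta : R, 0 < eps /\ 0 < delta /\
    forall n m : nat, (2 <= n)%N -> (1 <= m)%N ->
      `|n%:R - m%:R| > n%:R / (ln (n%:R : R)) `^ (1 + eps) ->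
      `|e n - e m| > delta.

(* Main.v *)
(**
Write [f x = ln |2 cos x|]; the claim is that the means of [f (e_k t)] tend to
[0] for almost every [t].  The partial sums
[Q_J x = \sum_(j <= J) (-1)^(j+1) cos (2 j x) / j] of the Fourier series of [f]
converge to [f] wherever [cos x <> 0].  On [[-T, T]] with the weight
[1 - (t / T)^2], whose Fourier transform decays quadratically, the exponentials
[t |-> cos (l_i t)] are almost orthogonal as soon as few of the [l_i] fall in any
interval of fixed length.  Used with [l_j = 2 j e] this gives, by Fatou's lemma,
[f - Q_J = O(J^(-1/2))] in [L^2], uniformly in [e]; used with [l_k = 2 j e_k] it
bounds the mean of [Q_J (e_k t)], since the growth condition leaves at most
[O(N / (ln N)^(1 + eps))] of [e_1, ..., e_N] in an interval of length [delta].
With [J = k^2] the means over the first [N_k] terms have summable [L^2] norms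
along every sequence with [N_(k+1) / N_k] close to [1 + 1 / (p + 1)], hence
tend to [0] almost everywhere along it.  As [f <= ln 2], the means cannot move
much between consecutive [N_k], which settles the whole sequence.
*)
Require Import Defs.
From mathcomp Require Import all_boot all_order all_algebra.
From mathcomp Require Import all_classical all_reals all_analysis.
From mathcomp Require Import measurable_realfun.
From mathcomp Require Import ring lra.
Import Order.TTheory GRing.Theory Num.Theory.
Import numFieldNormedType.Exports.
Set Implicit Arguments. Unset Strict Implicit. Unset Printing Implicit Defensive.
Local Open Scope classical_set_scope.
Local Open Scope ring_scope.

(** * Fourier polynomials of the logarithm of the cosine *)

(** Weighted Cauchy-Schwarz. Adding an index [i] raises the right side minus the left side by [c i]
    times the sum of [c j * (x i - x j) ^+ 2], which is nonnegative. *)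
Lemma sqr_wsum_le (R : realType) (I : Type) (r : seq I) (c x : I -> R) :
  (forall i, 0 <= c i) ->
  (\sum_(i <- r) c i * x i) ^+ 2 <=
  (\sum_(i <- r) c i) * \sum_(i <- r) c i * x i ^+ 2.
Proof.
move=> c0; elim: r => [|i r IH]; first by rewrite !big_nil expr0n mulr0.
rewrite !big_cons; move: IH.
have A0 : 0 <= \sum_(j <- r) c j by exact: sumr_ge0.
have : 0 <= \sum_(j <- r) c j * (x i - x j) ^+ 2.
  by apply: sumr_ge0 => j _; rewrite mulr_ge0 ?sqr_ge0.
have -> : \sum_(j <- r) c j * (x i - x j) ^+ 2 =
   x i ^+ 2 * (\sum_(j <- r) c j) - x i *+ 2 * (\sum_(j <- r) c j * x j)
   + \sum_(j <- r) c j * x j ^+ 2.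
  rewrite !mulr_sumr -sumrB -big_split /=.
  by apply: eq_bigr => j _; ring.
move: A0 (c0 i); move: (\sum_(j <- r) c j) => A.
move: (\sum_(j <- r) c j * x j) => B.
move: (\sum_(j <- r) c j * x j ^+ 2) => C A0 ci h1 h2.
have := mulr_ge0 ci h1; nra.
Qed.

Lemma cos_step_add (R : realType) (n : nat) (y : R) :
  cos (n.+2%:R * y) + cos (n%:R * y) = 2 * cos y * cos (n.+1%:R * y).
Proof.
have -> : n.+2%:R * y = n.+1%:R * y + y by rewrite -addn1 natrD mulrDl mul1r.
have -> : n%:R * y = n.+1%:R * y - y.
  by rewrite -[n.+1]addn1 natrD mulrDl mul1r addrK.
by rewrite cosD cosB; ring.
Qed.

(** The sum is the real part of a geometric series of ratio [- p e^(iy)], and the factor in front is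
    [|1 + p e^(iy)|^2]; with [cos_step_add] the product telescopes. *)
Lemma cos_geo_sum (R : realType) (J : nat) (p y : R) :
  (1 + 2 * p * cos y + p ^+ 2) *
    \sum_(j < J) (-1) ^+ j * p ^+ j * cos (j.+1%:R * y) =
  cos y + p - (-1) ^+ J * p ^+ J * (cos (J.+1%:R * y) + p * cos (J%:R * y)).
Proof.
elim: J => [|J IH]; first by rewrite big_ord0 !mul1r mul0r cos0; ring.
rewrite big_ord_recr /= mulrDr {}IH.
have := cos_step_add J y; rewrite !exprS; move: (cos (J.+2%:R * y)) => a.
move/(congr1 (fun z => z - cos (J%:R * y))); rewrite addrK => ->; ring.
Qed.

(** The ordinal [j] stands for the Fourier index [j + 1], hence the sign [(-1) ^+ j]. *)
Definition log2cos_poly (R : realType) (J : nat) (x : R) : R :=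
  \sum_(j < J) (-1) ^+ j / j.+1%:R * cos (j.+1%:R * (2 * x)).

(** This rule and the next ones are stated for explicit lambdas, so that they nest as terms under
    [is_derive_eq] and leave only an algebraic identity to check. *)
Lemma is_derive1_scale (R : realType) (f : R -> R) (k x df : R) :
  is_derive x 1 f df -> is_derive x 1 (fun t => k * f t) (k * df).
Proof. exact: is_deriveZ. Qed.

Lemma is_derive1_add (R : realType) (f g : R -> R) (x df dg : R) :
  is_derive x 1 f df -> is_derive x 1 g dg ->
  is_derive x 1 (fun t => f t + g t) (df + dg).
Proof. exact: is_deriveD. Qed.

Lemma is_derive1_sub (R : realType) (f g : R -> R) (x df dg : R) :
  is_derive x 1 f df -> is_derive x 1 g dg ->
  is_derive x 1 (fun t => f t - g t) (df - dg).
Proof. exact: is_deriveB. Qed.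

Lemma is_derive1_mul (R : realType) (f g : R -> R) (x df dg : R) :
  is_derive x 1 f df -> is_derive x 1 g dg ->
  is_derive x 1 (fun t => f t * g t) (f x * dg + g x * df).
Proof. exact: is_deriveM. Qed.

Lemma is_derive1_sum (R : realType) (I : finType) (f : I -> R -> R) (x : R)
    (df : I -> R) : (forall i, is_derive x 1 (f i) (df i)) ->
  is_derive x 1 (fun t => \sum_i f i t) (\sum_i df i).
Proof.
move=> h; have -> : (fun t => \sum_i f i t) = \sum_i f i.
  by apply/funext => z; rewrite fct_sumE.
by elim/big_ind2 : _ => // *; [exact: is_derive_cst|exact: is_deriveD].
Qed.

Lemma is_derive1_expn (R : realType) (n : nat) (x : R) :
  is_derive x 1 (fun t => t ^+ n.+1) (n.+1%:R * x ^+ n).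
Proof.
have h : is_derive x 1 (id : R -> R) 1 by exact: is_derive_id.
have := is_deriveX n.+1 h.
by rewrite fctE /GRing.scale /= mulr1.
Qed.

Lemma le_endpoints (R : realType) (g dg : R -> R) (a b : R) : a <= b ->
  (forall x, x \in `[a, b] -> is_derive x 1 g (dg x)) ->
  (forall x, x \in `[a, b] -> 0 <= dg x) -> g a <= g b.
Proof.
move=> ab Dg dg0; rewrite -subr_ge0.
have Dg' x : x \in `]a, b[ -> is_derive x 1 g (dg x).
  by move=> xab; apply: Dg; exact: subset_itv_oo_cc.
have cg : {within `[a, b], continuous g}.
  by apply: derivable_within_continuous => x xab; apply: ex_derive; exact: Dg.
have [c cab E] := MVT_segment ab Dg' cg.
by rewrite E mulr_ge0 ?subr_ge0 // dg0.
Qed.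

(* Compare the [p]-derivatives of [ln (1 + 2 p cos (2 x) + p^2) / 2] and of its
   power series truncated at degree [J] on [0 <= p <= 1]; at [p = 1] the
   logarithm is [ln |2 cos x|]. *)
Lemma log2cos_poly_err (R : realType) (J : nat) (x : R) : cos x != 0 ->
  `|ln `|cos x| + ln 2 - log2cos_poly J x| <= 2 / (J.+1%:R * cos x ^+ 2).
Proof.
move=> cx0; set y := 2 * x.
have m0 : 0 < cos x ^+ 2 by rewrite exprn_even_gt0.
have cy : cos y = 2 * cos x ^+ 2 - 1.
  by rewrite /y mulrC mulr_natr cos_mulr2n mulr2n; ring.
set m := cos x ^+ 2 in m0 cy *.
have m1 : m <= 1 by rewrite /m; have := cos2Dsin2 x; have := sqr_ge0 (sin x); lra.
pose q (p : R) := 1 + 2 * p * cos y + p ^+ 2.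
(* Indeed [q p - m = (1 - m) (1 - p)^2 + m p (2 + p)]. *)
have qm (p : R) : p \in `[0, 1] -> m <= q p.
  rewrite in_itv /= => /andP[p0 p1]; rewrite /q cy.
  have h1 : 0 <= m * (p * (2 + p)).
    by apply: mulr_ge0; [exact: ltW | apply: mulr_ge0 => //; lra].
  have h2 : 0 <= (1 - m) * (1 - p) ^+ 2 by rewrite mulr_ge0 ?sqr_ge0 ?subr_ge0.
  by lra.
(* The signs [s = 1] and [s = -1] yield the two sides of the absolute value. The last term has
   derivative [2 / m * p ^+ J], just enough to make [g s] nondecreasing; at [p = 1] it is the
   claimed error. *)
pose g (s p : R) := s * (2^-1 * ln (q p) -
   \sum_(j < J) ((-1) ^+ j / j.+1%:R * cos (j.+1%:R * y)) * p ^+ j.+1)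
   + 2 / (J.+1%:R * m) * p ^+ J.+1.
pose dg (s p : R) := s * ((cos y + p) / q p -
   \sum_(j < J) (-1) ^+ j * p ^+ j * cos (j.+1%:R * y)) + 2 / m * p ^+ J.
have Dg (s p : R) : p \in `[0, 1] -> is_derive p 1 (g s) (dg s p).
  move=> p01; have q0 : 0 < q p by exact: lt_le_trans (qm p p01).
  have Dq : is_derive p 1 q (2 * (cos y + p)).
    rewrite /q; apply: is_derive_eq; rewrite /GRing.scale /=; ring.
  have Dl : is_derive p 1 (fun p => ln (q p)) ((q p)^-1 * (2 * (cos y + p))).
    have Dln := is_derive1_ln q0.
    exact: (is_derive1_comp Dln Dq).
  have Ds : is_derive p 1 (fun p : R => \sum_(j < J)
      ((-1) ^+ j / j.+1%:R * cos (j.+1%:R * y)) * p ^+ j.+1)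
      (\sum_(j < J) (-1) ^+ j * p ^+ j * cos (j.+1%:R * y)).
    apply: is_derive1_sum => j.
    apply: (is_derive_eq (is_derive1_scale _ (is_derive1_expn _ _))).
    have := pnatr_eq0 R j.+1; move: (j.+1%:R) => a /= a0.
    by field; rewrite a0.
  apply: (is_derive_eq (is_derive1_add
    (is_derive1_scale _ (is_derive1_sub (is_derive1_scale _ Dl) Ds))
    (is_derive1_scale _ (is_derive1_expn _ _)))).
  rewrite /dg; have := pnatr_eq0 R J.+1; move: (J.+1%:R) => a /= a0.
  by field; rewrite a0 !gt_eqF.
have dg0 (s p : R) : `|s| = 1 -> p \in `[0, 1] -> 0 <= dg s p.
  move=> s1 p01; have q0 : 0 < q p by exact: lt_le_trans (qm p p01).
  rewrite /dg.
  have -> : \sum_(j < J) (-1) ^+ j * p ^+ j * cos (j.+1%:R * y) =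
     (cos y + p) / q p -
     (-1) ^+ J * p ^+ J * (cos (J.+1%:R * y) + p * cos (J%:R * y)) / q p.
    apply: (mulfI (lt0r_neq0 q0)); rewrite cos_geo_sum.
    by field; rewrite gt_eqF.
  rewrite subKr.
  move: p01 (qm p p01); rewrite in_itv /= => /andP[p0 p1] qmp.
  (* The remainder of the geometric sum has numerator at most [2 p^J] and denominator [q p >= m]. *)
  suff : `|s * ((-1) ^+ J * p ^+ J * (cos (J.+1%:R * y) + p * cos (J%:R * y)) / q p)|
     <= 2 / m * p ^+ J.
    by move=> /ler_normlP[h _]; rewrite addrC -lerBlDr sub0r.
  rewrite normrM s1 mul1r !normrM normrX normrN1 expr1n mul1r normrX (ger0_norm p0).
  rewrite normrV ?unitfE ?gt_eqF // (gtr0_norm q0).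
  rewrite [leRHS]mulrC -mulrA ler_wpM2l ?exprn_ge0 // ler_pM ?invr_ge0 ?(ltW q0) //.
    rewrite (le_trans (ler_normD _ _)) //.
    rewrite normrM (ger0_norm p0).
    have := cos_max (J.+1%:R * y); have := cos_max (J%:R * y).
    have := normr_ge0 (cos (J%:R * y)); nra.
  by rewrite lef_pV2.
have gE (s : R) : `|s| = 1 -> 0 <= s * (ln `|cos x| + ln 2 - log2cos_poly J x)
   + 2 / (J.+1%:R * m).
  move=> s1; have := le_endpoints ler01 (Dg s) (fun p => @dg0 s p s1).
  have -> : g s 0 = 0.
    rewrite /g /q !expr0n /= mulr0 mul0r !addr0 ln1 mulr0 big1 ?subrr ?mulr0 ?addr0 //.
    by move=> j _; rewrite expr0n mulr0.
  rewrite /g !expr1n mulr1 /log2cos_poly -/y.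
  have -> : \sum_(j < J) (-1) ^+ j / j.+1%:R * cos (j.+1%:R * y) * 1 ^+ j.+1 =
    \sum_(j < J) (-1) ^+ j / j.+1%:R * cos (j.+1%:R * y).
    by apply: eq_bigr => j _; rewrite expr1n mulr1.
  suff -> : ln `|cos x| + ln 2 = 2^-1 * ln (q 1) by [].
  have -> : q 1 = (`|cos x| * 2) ^+ 2.
    by rewrite exprMn real_normK ?num_real // /q cy /m; ring.
  by rewrite lnXn ?mulr_gt0 ?normr_gt0 // lnM ?posrE ?normr_gt0 // mulr2n; field.
have := gE 1 (normr1 _); have := gE (-1) (normrN1 _).
move: (2 / (J.+1%:R * m)) (_ - log2cos_poly J x) => a b.
by rewrite mulN1r mul1r ler_norml => h1 h2; apply/andP; split; lra.
Qed.

(** * Weighted mean squares of cosine sums *)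

Definition weight (R : realType) (T t : R) : R := 1 - (t / T) ^+ 2.

Lemma weight_bounds (R : realType) (T t : R) : 0 < T -> t \in `[- T, T] ->
  0 <= weight T t <= 1.
Proof.
move=> T0; rewrite in_itv /= -ler_norml => tT; rewrite /weight.
have : (t / T) ^+ 2 <= 1.
  by rewrite -real_normK ?num_real // expr_le1 // normrM normfV (gtr0_norm T0)
    ler_pdivrMr // mul1r.
by have := sqr_ge0 (t / T); lra.
Qed.

Lemma weight_gt0 (R : realType) (T t : R) : 0 < T -> `|t| < T -> 0 < weight T t.
Proof.
move=> T0 tT; rewrite /weight subr_gt0 -real_normK ?num_real // expr_lt1 //.
by rewrite normrM normfV (gtr0_norm T0) ltr_pdivrMr // mul1r.
Qed.

Lemma is_derive_scaled_arg (R : realType) (f df : R -> R) (a x : R) :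
  (forall y : R, is_derive y 1 f (df y)) ->
  is_derive x 1 (fun t => f (a * t)) (a * df (a * x)).
Proof.
move=> Df.
have Da : is_derive x 1 (fun t : R => a * t) (a * 1).
  by apply: is_derive1_scale; exact: is_derive_id.
have := is_derive1_comp (Df (a * x)) Da.
by rewrite mulr1 mulrC.
Qed.

Lemma is_derive_weight (R : realType) (T x : R) :
  is_derive x 1 (weight T) (- (2 * x / T ^+ 2)).
Proof.
have -> : weight T = (fun t => 1 - T ^- 2 * t ^+ 2).
  by apply/funext => t; rewrite /weight expr_div_n mulrC.
apply: (is_derive_eq (is_derive1_sub (is_derive_cst (1 : R) x 1)
  (is_derive1_scale _ (is_derive1_expn _ _)))).
by rewrite expr1 sub0r mulrC.
Qed.

(** The weight vanishes at [T] and [- T], so integration by parts leaves no term of order [1 / a]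
    and the decay is quadratic. For [|a| <= 1] the mean value theorem gives [2 T]; for [|a| > 1] the
    explicit primitive gives [8 / a^2]. Both are below the stated bound since [T >= 1]. *)
Lemma weight_cos_primitive (R : realType) (T a : R) : 1 <= T ->
  exists A : R -> R, (forall t : R, is_derive t 1 A (weight T t * cos (a * t))) /\
    `|A T - A (- T)| <= 16 * T / (1 + a ^+ 2).
Proof.
move=> T1; have T0 : 0 < T by exact: lt_le_trans T1.
have TN0 : T != 0 by rewrite gt_eqF.
have a2 := sqr_ge0 a.
have small A : `|a| <= 1 ->
    (forall t : R, is_derive t 1 A (weight T t * cos (a * t))) ->
    `|A T - A (- T)| <= 16 * T / (1 + a ^+ 2).
  move=> a1 DA.
  have [||c cT ->] := @MVT_segment _ A (fun t => weight T t * cos (a * t)) (- T) T.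
  - by lra.
  - by apply: derivable_within_continuous => x _; apply: ex_derive; exact: DA.
  have /andP[w0 w1] := weight_bounds T0 cT.
  have a21 : a ^+ 2 <= 1 by rewrite -real_normK ?num_real // expr_le1.
  rewrite opprK !normrM (ger0_norm w0) (@ger0_norm _ (T + T)); last by lra.
  rewrite ler_pdivlMr; last by lra.
  have c1 := cos_max (a * c); have c0 := normr_ge0 (cos (a * c)).
  have X1 : weight T c * `|cos (a * c)| <= 1 by nra.
  apply: (@le_trans _ _ (1 * (T + T) * (1 + 1))); last by lra.
  by do 2!(apply: ler_pM => //; rewrite ?mulr_ge0 //; try lra).
have [a0|aN0] := eqVneq a 0.
  have DA (t : R) : is_derive t 1 (fun t => t - (3 * T ^+ 2)^-1 * t ^+ 3)
      (weight T t * cos (a * t)).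
    apply: (is_derive_eq (is_derive1_sub (is_derive_id t 1)
      (is_derive1_scale _ (is_derive1_expn _ _)))).
    by rewrite /weight a0 mul0r cos0; field; rewrite TN0.
  exists (fun t => t - (3 * T ^+ 2)^-1 * t ^+ 3); split => //.
  by apply: small => //; rewrite a0 normr0.
(* The primitive obtained by integrating by parts twice. *)
pose P t := a^-1 * (weight T t * sin (a * t)) -
  2 / (a * T) ^+ 2 * (t * cos (a * t)) + 2 / (a ^+ 3 * T ^+ 2) * sin (a * t).
have DP (t : R) : is_derive t 1 P (weight T t * cos (a * t)).
  have DS := is_derive_scaled_arg a t (@is_derive_sin R).
  have DC := is_derive_scaled_arg a t (@is_derive_cos R).
  apply: (is_derive_eq (is_derive1_add (is_derive1_sub
    (is_derive1_scale _ (is_derive1_mul (is_derive_weight T t) DS))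
    (is_derive1_scale _ (is_derive1_mul (is_derive_id t 1) DC)))
    (is_derive1_scale _ DS))).
  by rewrite /weight; field; rewrite aN0 TN0.
exists P; split => //.
have [a1|a1] := leP `|a| 1; first exact: small.
rewrite /P /weight !mulrN !cosN !sinN.
rewrite (_ : _ - _ = - (4 * cos (a * T) / (a ^+ 2 * T)) +
   4 * sin (a * T) / (a ^+ 3 * T ^+ 2)); last by field; rewrite aN0 TN0.
have T0' := ltW T0.
have a21 : 1 < a ^+ 2 by rewrite -(real_normK (num_real a)) exprn_egt1.
have a20 : 0 < a ^+ 2 by lra.
apply: (le_trans (ler_normD _ _)).
have p0 : 0 <= a ^+ 2 * T by exact: mulr_ge0.
have h1 : `|- (4 * cos (a * T) / (a ^+ 2 * T))| <= 4 / a ^+ 2.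
  rewrite normrN normrM normfV (@ger0_norm _ (_ ^+ 2 * _)) //.
  rewrite normrM (@ger0_norm _ 4) //.
  apply: ler_pM; rewrite ?invr_ge0 //.
    by rewrite ger_pMr // cos_max.
  rewrite lef_pV2 ?posrE ?ler_peMr //.
  exact: mulr_gt0.
have h2 : `|4 * sin (a * T) / (a ^+ 3 * T ^+ 2)| <= 4 / a ^+ 2.
  rewrite normrM normfV normrM (@ger0_norm _ 4) //.
  apply: ler_pM; rewrite ?invr_ge0 //.
    by rewrite ger_pMr // sin_max.
  rewrite normrM exprSr normrM (ger0_norm a2) (@ger0_norm _ (T ^+ 2)) ?sqr_ge0 //.
  have T2 : 1 <= T ^+ 2 by rewrite expr_ge1.
  have q1 : 1 <= `|a| * T ^+ 2 by rewrite -[1]mulr1 ler_pM // ltW.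
  rewrite -mulrA lef_pV2 ?posrE ?ler_peMr //.
  by rewrite pmulr_rgt0 // (lt_le_trans _ q1).
apply: (le_trans (lerD h1 h2)).
rewrite ler_pdivlMr; last by lra.
rewrite -mulrDl mulrAC ler_pdivrMr //.
apply: (@le_trans _ _ (16 * a ^+ 2)); first by lra.
by rewrite ler_wpM2r // ler_peMr.
Qed.

Lemma continuous_of_derive (R : realType) (g dg : R -> R) :
  (forall t : R, is_derive t 1 g (dg t)) -> continuous g.
Proof.
move=> Dg t; apply/differentiable_continuous/derivable1_diffP.
by apply: ex_derive; exact: Dg.
Qed.

Lemma continuous_cosM (R : realType) (a : R) : continuous (fun t : R => cos (a * t)).
Proof.
by apply: continuous_of_derive => t; exact: is_derive_scaled_arg (@is_derive_cos R).
Qed.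

Lemma continuous_weight (R : realType) (T : R) : continuous (@weight R T).
Proof. by apply: continuous_of_derive => t; exact: is_derive_weight. Qed.

Lemma continuous_sum_fun (R : realType) (I : Type) (r : seq I) (f : I -> R -> R) :
  (forall i, continuous (f i)) -> continuous (fun t => \sum_(i <- r) f i t).
Proof.
move=> cf t; elim: r => [|i r IH].
  by under eq_fun do rewrite big_nil; exact: cst_continuous.
under eq_fun do rewrite big_cons.
by apply: cvgD; [exact: cf|exact: IH].
Qed.

Lemma continuous_cos_sum (R : realType) (N : nat) (b l : 'I_N -> R) :
  continuous (fun t : R => \sum_i b i * cos (l i * t)).
Proof.
apply: continuous_sum_fun => i t.
by apply: cvgM; [exact: cvg_cst|exact: continuous_cosM].
Qed.

Lemma integral_primitive (R : realType) (g G : R -> R) (a b : R) : a < b ->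
  continuous g -> (forall t : R, is_derive t 1 G (g t)) ->
  (\int[@lebesgue_measure R]_(t in `[a, b]) (g t)%:E = (G b - G a)%:E)%E.
Proof.
move=> ab cg DG; have cG := continuous_of_derive DG.
rewrite (@continuous_FTC2 _ g G) //.
- exact: continuous_subspaceT.
- split => /= [x _||]; first by apply: ex_derive; exact: DG.
  + by apply: cvg_at_right_filter; exact: cG.
  + by apply: cvg_at_left_filter; exact: cG.
- by move=> x _; rewrite derive1E derive_val.
Qed.

(** Schur's test: [2 |b i b j| <= b i ^ 2 + b j ^ 2], and the symmetry of [K] makes the two halves
    equal. *)
Lemma sum_sym_bound (R : realType) (N : nat) (b : 'I_N -> R)
    (A K : 'I_N -> 'I_N -> R) :
  (forall i j, `|A i j| <= K i j) -> (forall i j, K i j = K j i) ->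
  \sum_i \sum_j b i * b j * A i j <= \sum_i b i ^+ 2 * \sum_j K i j.
Proof.
move=> AK Ksym.
apply: (@le_trans _ _ (\sum_i \sum_j
    (b i ^+ 2 * K i j / 2 + b j ^+ 2 * K i j / 2))).
  apply: ler_sum => i _; apply: ler_sum => j _.
  apply: (le_trans (ler_norm _)); rewrite normrM.
  apply: (@le_trans _ _ (`|b i * b j| * K i j)).
    by rewrite ler_wpM2l.
  rewrite -mulrDl -mulrDl mulrAC ler_wpM2r ?(le_trans _ (AK i j)) //.
  rewrite normrM -(real_normK (num_real (b i))) -(real_normK (num_real (b j))).
  by have := sqr_ge0 (`|b i| - `|b j|); lra.
under eq_bigr do rewrite big_split /=.
rewrite big_split /= [X in _ + X]exchange_big /=.
rewrite -big_split /=; apply: ler_sum => i _.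
rewrite mulr_sumr -big_split /=; apply: ler_sum => j _.
by rewrite (Ksym j i); lra.
Qed.

(* Adding the square of the sine sum leaves only the frequencies [l i - l j]. *)
Lemma weighted_cos_sum_L2 (R : realType) (T : R) (N : nat) (b l : 'I_N -> R) :
  1 <= T ->
  (\int[@lebesgue_measure R]_(t in `[(- T)%R, T])
     (weight T t * (\sum_i b i * cos (l i * t)) ^+ 2)%:E <=
   (\sum_i b i ^+ 2 * \sum_j 16 * T / (1 + (l i - l j) ^+ 2))%:E)%E.
Proof.
move=> T1; have T0 : 0 < T by exact: lt_le_trans T1.
have /choice[A hA] : forall a : R, exists A : R -> R,
    (forall t : R, is_derive t 1 A (weight T t * cos (a * t))) /\
    `|A T - A (- T)| <= 16 * T / (1 + a ^+ 2).
  by move=> a; exact: weight_cos_primitive.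
pose h t := \sum_i \sum_j b i * b j * (weight T t * cos ((l i - l j) * t)).
pose H t := \sum_i \sum_j b i * b j * A (l i - l j) t.
have hE (t : R) : h t = weight T t * ((\sum_i b i * cos (l i * t)) ^+ 2
                              + (\sum_i b i * sin (l i * t)) ^+ 2).
  rewrite !expr2 !big_distrlr /= -big_split /= mulr_sumr.
  apply: eq_bigr => i _; rewrite -big_split /= mulr_sumr.
  by apply: eq_bigr => j _; rewrite (mulrBl t (l i)) cosB; ring.
have DH (t : R) : is_derive t 1 H (h t).
  apply: is_derive1_sum => i; apply: is_derive1_sum => j.
  by apply: is_derive1_scale; exact: (hA _).1.
have cw := @continuous_weight R T.
have ch : continuous h.
  apply: continuous_sum_fun => i; apply: continuous_sum_fun => j t.
  apply: cvgM; first exact: cvg_cst.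
  by apply: cvgM; [exact: cw|exact: continuous_cosM].
apply: (@le_trans _ _ (\int[@lebesgue_measure R]_(t in `[(- T)%R, T]) (h t)%:E)%E).
  apply: ge0_le_integral => //.
  - move=> t /= tT; rewrite lee_fin mulr_ge0 ?sqr_ge0 //.
    by have /andP[] := weight_bounds T0 tT.
  - apply/measurable_EFinP; apply: measurable_funTS.
    apply: continuous_measurable_fun => t; apply: cvgM; first exact: cw.
    by apply: cvgM; exact: continuous_cos_sum.
  - apply/measurable_EFinP; apply: measurable_funTS.
    exact: continuous_measurable_fun.
  - move=> t /= tT; rewrite lee_fin hE ler_wpM2l ?lerDl ?sqr_ge0 //.
    by have /andP[] := weight_bounds T0 tT.
rewrite (@integral_primitive _ h H) //; last by lra.
rewrite lee_fin /H -sumrB.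
under eq_bigr do rewrite -sumrB.
under eq_bigr do under eq_bigr do rewrite -mulrBr.
apply: (@sum_sym_bound _ _ b _ (fun i j => 16 * T / (1 + (l i - l j) ^+ 2))).
  by move=> i j; exact: (hA _).2.
by move=> i j; rewrite -(opprB (l j)) sqrrN.
Qed.

(** * Well-spaced frequencies *)

(** The term [k = 0] gives [1]; the others are at most [2 / (k (k + 1) d^2)], which telescopes. The
    induction keeps the slack [2 / m.+1%:R]. *)
Lemma sum_inv_sqr_le (R : realType) (d : R) (n : nat) : 0 < d ->
  \sum_(k < n) (1 + (k%:R * d) ^+ 2)^-1 <= 1 + 2 / d ^+ 2.
Proof.
move=> d0; have d2 : 0 < d ^+ 2 by exact: exprn_gt0.
suff h m : \sum_(k < m.+1) (1 + (k%:R * d) ^+ 2)^-1 <=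
    1 + (2 - 2 / m.+1%:R) / d ^+ 2.
  case: n => [|n]; first by rewrite big_ord0 addr_ge0 // divr_ge0 // ltW.
  apply: (le_trans (h n)); rewrite lerD2l ler_pM2r ?invr_gt0 //.
  by rewrite gerBl divr_ge0.
elim: m => [|m IH].
  by rewrite big_ord1 mul0r expr0n addr0 invr1 mulr1 subrr mul0r addr0.
rewrite big_ord_recr /=; apply: (le_trans (lerD IH (lexx _))).
rewrite -addrA lerD2l -lerBrDl -mulrBl.
have m1 : 1 <= m.+1%:R :> R by rewrite ler1n.
have -> : m.+2%:R = m.+1%:R + 1 :> R by rewrite -natr1.
move: (m.+1%:R) m1 => a ge1a; have a0 : 0 < a by lra.
have a1 : 0 < a + 1 by lra.
rewrite (_ : 2 - _ - _ = 2 / (a * (a + 1))); last first.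
  by field; rewrite !gt_eqF.
rewrite -mulrA -invfM exprMn.
apply: (@le_trans _ _ (a ^+ 2 * d ^+ 2)^-1).
  rewrite lef_pV2 ?posrE ?addr_gt0 ?mulr_gt0 ?exprn_gt0 //.
  by rewrite lerDr.
have aa : 0 < a ^+ 2 by exact: exprn_gt0.
have p1 : 0 < a ^+ 2 * d ^+ 2 by exact: mulr_gt0.
have p2 : 0 < a * (a + 1) * d ^+ 2 by rewrite mulr_gt0 // mulr_gt0.
rewrite ler_pdivlMr // mulrC ler_pdivrMr // [leRHS]mulrA.
apply: ler_wpM2r; first exact: ltW.
by rewrite expr2; nra.
Qed.

(** The indices are sorted by [r j], the distance from [x] to [l j] in units of [d], rounded down.
    Each class lies in two intervals of length [d], one on each side of [x], so it has at most [2 K]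
    members, all at distance at least [k d]. *)
Lemma sum_bins_le (R : realType) (N : nat) (l : 'I_N -> R) (d K x : R) :
  0 < d ->
  (forall y : R, #|[set i | y <= l i <= y + d]%SET|%:R <= K) ->
  \sum_j (1 + (x - l j) ^+ 2)^-1 <= 2 * K * (1 + 2 / d ^+ 2).
Proof.
move=> d0 hK.
have K0 : 0 <= K by apply: le_trans (hK 0); rewrite ler0n.
pose r j := Num.truncn (`|x - l j| / d).
have rP j : (r j)%:R * d <= `|x - l j| < (r j)%:R * d + d.
  have h0 : 0 <= `|x - l j| / d by rewrite divr_ge0 // ltW.
  have /andP[h1 h2] := truncn_itv h0.
  rewrite -ler_pdivlMr // h1 /=; move: h2; rewrite ltr_pdivrMr // -natr1.
  by rewrite mulrDl mul1r.
pose M := (\max_j r j).+1.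
have rM j : (r j < M)%N by rewrite ltnS; exact: leq_bigmax.
have -> : \sum_j (1 + (x - l j) ^+ 2)^-1 =
    \sum_(k < M) \sum_(j | r j == k) (1 + (x - l j) ^+ 2)^-1.
  rewrite (exchange_big_dep xpredT) //=.
  apply: eq_bigr => j _.
  by rewrite (big_pred1 (Ordinal (rM j))) // => k; rewrite -val_eqE eq_sym.
apply: (@le_trans _ _ (\sum_(k < M) 2 * K * (1 + (k%:R * d) ^+ 2)^-1)); last first.
  by rewrite -mulr_sumr ler_wpM2l ?mulr_ge0 // sum_inv_sqr_le.
apply: ler_sum => k _.
apply: (@le_trans _ _ (\sum_(j | r j == k) (1 + (k%:R * d) ^+ 2)^-1)).
  apply: ler_sum => j /eqP <-.
  have /andP[h _] := rP j.
  rewrite lef_pV2 ?posrE ?ltr_wpDr ?sqr_ge0 // lerD2l.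
  by rewrite -(real_normK (num_real (x - l j))) lerXn2r ?nnegrE ?mulr_ge0 // ltW.
rewrite sumr_const -[leLHS]mulr_natl ler_wpM2r ?invr_ge0 ?addr_ge0 ?sqr_ge0 //.
apply: (@le_trans _ _ (#|[set i | x + k%:R * d <= l i <= x + k%:R * d + d]%SET|%:R +
   #|[set i | x - k%:R * d - d <= l i <= x - k%:R * d - d + d]%SET|%:R)); last first.
  by rewrite (_ : 2 * K = K + K); [apply: lerD; exact: hK | ring].
rewrite -natrD ler_nat.
apply: leq_trans (leq_card_setU _ _); apply: subset_leq_card.
apply/fintype.subsetP => j; rewrite !inE => /eqP rk.
have := rP j; rewrite rk; case: (lerP (l j) x) => [lx|xl] /andP[h1 h2].
  by apply/orP; right; apply/andP; split; lra.
by apply/orP; left; apply/andP; split; lra.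
Qed.

(** Fatou's lemma when the lower limit is a true limit; it carries bounds uniform in the degree over
    to the infinite Fourier tail. *)
Lemma fatou_bound (R : realType) (D : set R) (g : nat -> R -> R) (h : R -> R) (c : R) :
  measurable D -> (forall n, measurable_fun D (g n)) ->
  (forall n t, D t -> 0 <= g n t) ->
  (forall t, D t -> g n t @[n --> \oo] --> h t) ->
  (forall n, (\int[@lebesgue_measure R]_(t in D) (g n t)%:E <= c%:E)%E) ->
  (\int[@lebesgue_measure R]_(t in D) (h t)%:E <= c%:E)%E.
Proof.
move=> mD mg g0 gh gc.
have -> : (\int[@lebesgue_measure R]_(t in D) (h t)%:E =
    \int[@lebesgue_measure R]_(t in D) limn_einf (fun n => (g n t)%:E))%E.
  apply: eq_integral => t; rewrite inE => Dt.
  have gt : (g n t)%:E @[n --> \oo] --> (h t)%:E.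
    by apply: cvg_EFin; [exact: nearW|exact: gh].
  by have [-> _] := cvg_limn_einf_sup gt.
have mg' n : measurable_fun D (fun t => (g n t)%:E).
  by apply/measurable_EFinP; exact: mg.
have g0' n t : D t -> (0 <= (g n t)%:E)%E by move=> Dt; rewrite lee_fin g0.
apply: (le_trans (fatou (@lebesgue_measure R) mD mg' g0')).
rewrite limn_einf_lim; apply: lime_le; first exact: is_cvg_einfs.
apply: nearW => n; apply: (le_trans _ (gc n)).
by apply: ereal_inf_lbound; exists n => //=.
Qed.

Lemma integral_wsum_le (R : realType) (D : set R) (I : Type) (r : seq I)
    (k B : I -> R) (g : I -> R -> R) :
  measurable D -> (forall i, 0 <= k i) -> (forall i, measurable_fun D (g i)) ->
  (forall i t, D t -> 0 <= g i t) ->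
  (forall i, (\int[@lebesgue_measure R]_(t in D) (g i t)%:E <= (B i)%:E)%E) ->
  (\int[@lebesgue_measure R]_(t in D) (\sum_(i <- r) k i * g i t)%:E <=
    (\sum_(i <- r) k i * B i)%:E)%E.
Proof.
move=> mD k0 mg g0 gB.
under eq_integral do rewrite -sumEFin.
rewrite ge0_integral_sum //.
- rewrite -sumEFin; apply: lee_sum => i _.
  under eq_integral do rewrite EFinM.
  rewrite ge0_integralZl_EFin //.
  + by rewrite EFinM; apply: lee_wpmul2l; rewrite ?lee_fin.
  + by move=> t Dt; rewrite lee_fin g0.
  + by apply/measurable_EFinP; exact: mg.
- by move=> i; apply/measurable_EFinP; apply: measurable_funM => //; exact: mg.
- by move=> i t Dt; rewrite lee_fin mulr_ge0 // g0.
Qed.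

Lemma sum_tail_inv_sqr (R : realType) (J M : nat) :
  \sum_(i < M) (J + i).+1%:R ^- 2 <= 2 / J.+1%:R :> R.
Proof.
suff : \sum_(i < M) (J + i).+1%:R ^- 2 <= 2 / J.+1%:R - 2 / (J + M).+1%:R :> R.
  by move=> h; apply: (le_trans h); rewrite gerBl divr_ge0.
elim: M => [|M IH]; first by rewrite big_ord0 addn0 subrr.
rewrite big_ord_recr /= addnS; apply: (le_trans (lerD IH (lexx _))).
rewrite -addrA lerD2l.
have a1 : 1 <= (J + M).+1%:R :> R by rewrite ler1n.
have -> : (J + M).+2%:R = (J + M).+1%:R + 1 :> R by rewrite -natr1.
move: ((J + M).+1%:R) a1 => a a1.
have a0 : 0 < a by lra.
have a2 : 0 < a + 1 by lra.
have aa : 0 < a ^+ 2 by exact: exprn_gt0.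
rewrite addrC lerBlDr.
rewrite (_ : - _ + _ = 2 / (a * (a + 1))); last first.
  by field; rewrite !gt_eqF.
rewrite ler_pdivlMr ?mulr_gt0 // mulrC ler_pdivrMr //.
by rewrite expr2; nra.
Qed.

Lemma continuous_log2cos_poly (R : realType) (J : nat) (e : R) :
  continuous (fun t : R => log2cos_poly J (e * t)).
Proof.
have -> : (fun t : R => log2cos_poly J (e * t)) = fun t =>
    \sum_(j < J) (-1) ^+ j / j.+1%:R * cos ((j.+1%:R * (2 * e)) * t).
  by apply/funext => t; apply: eq_bigr => j _; rewrite !mulrA.
exact: continuous_cos_sum.
Qed.

Lemma log2cos_poly_tail (R : realType) (J M : nat) (x : R) :
  log2cos_poly (J + M) x - log2cos_poly J x =
  \sum_(i < M) (-1) ^+ (J + i) / (J + i).+1%:R * cos ((J + i).+1%:R * (2 * x)).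
Proof.
apply/eqP; rewrite subr_eq addrC; apply/eqP.
by rewrite /log2cos_poly big_split_ord.
Qed.

(** Consecutive frequencies differ by [2 |e| > 1 / T], so a window of length [1 / T] holds at most
    one of them and [sum_bins_le] applies with [K = 1]. The bound depends neither on [e] nor on [M];
    the decay in [J] is that of the squared coefficients. *)
Lemma log2cos_tail_L2_trig (R : realType) (T e : R) (J M : nat) :
  1 <= T -> 1 < `|e| * T ->
  (\int[@lebesgue_measure R]_(t in `[(- T)%R, T])
    (weight T t * (log2cos_poly (J + M) (e * t) - log2cos_poly J (e * t)) ^+ 2)%:E
   <= (64 * T * (1 + 2 * T ^+ 2) / J.+1%:R)%:E)%E.
Proof.
move=> T1 eT; have T0 : 0 < T by exact: lt_le_trans T1.
pose b (i : 'I_M) : R := (-1) ^+ (J + i) / (J + i).+1%:R.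
pose l (i : 'I_M) : R := (J + i).+1%:R * (2 * e).
have -> : (\int[@lebesgue_measure R]_(t in `[(- T)%R, T])
    (weight T t * (log2cos_poly (J + M) (e * t) - log2cos_poly J (e * t)) ^+ 2)%:E
  = \int[@lebesgue_measure R]_(t in `[(- T)%R, T])
    (weight T t * (\sum_i b i * cos (l i * t)) ^+ 2)%:E)%E.
  apply: eq_integral => t _; rewrite log2cos_poly_tail.
  by congr (_ * _ ^+ 2)%:E; apply: eq_bigr => i _; rewrite /l !mulrA.
apply: (le_trans (weighted_cos_sum_L2 b l T1)); rewrite lee_fin.
have Ti : 0 < T^-1 by rewrite invr_gt0.
have cnt (y : R) : #|[set i | y <= l i <= y + T^-1]%SET|%:R <= 1 :> R.
  rewrite lern1; apply/card_le1_eqP => i j; rewrite !inE.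
  wlog ij : i j / (i <= j)%N.
    by move=> h hi hj; case: (leqP i j) => [|/ltnW] ij; [exact: h|apply/esym; exact: h].
  move=> /andP[i1 i2] /andP[j1 j2]; apply: val_inj.
  move: ij; rewrite leq_eqVlt => /predU1P[//|ltij]; exfalso.
  have : `|l j - l i| <= T^-1 by rewrite ler_norml; apply/andP; split; lra.
  rewrite /l -mulrBl normrM -natrB ?ltnS ?leq_add2l 1?ltnW // subSS subnDl.
  have ge1 : 1 <= (j - i)%N%:R :> R by rewrite ler1n subn_gt0.
  rewrite ger0_norm ?ler0n // normrM ger0_norm // => h.
  have : T^-1 < `|e| by rewrite -[T^-1]mul1r ltr_pdivrMr.
  have := normr_ge0 e; nra.
have bins x := sum_bins_le x Ti cnt.
apply: (@le_trans _ _ (\sum_i b i ^+ 2 * (16 * T * (2 * 1 * (1 + 2 / T^-1 ^+ 2))))).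
  apply: ler_sum => i _; rewrite ler_wpM2l ?sqr_ge0 // -mulr_sumr.
  by rewrite ler_wpM2l // mulr_ge0 // ltW.
rewrite -mulr_suml.
have -> : \sum_i b i ^+ 2 = \sum_(i < M) (J + i).+1%:R ^- 2.
  by apply: eq_bigr => i _; rewrite /b exprMn sqrr_sign mul1r exprVn.
apply: (le_trans (ler_wpM2r _ (sum_tail_inv_sqr R J M))).
  have u : 0 <= 2 / T^-1 ^+ 2 :> R by rewrite divr_ge0 // sqr_ge0.
  by apply: mulr_ge0; [lra | move: u; move: (2 / _) => u u0; lra].
rewrite exprVn invrK; set z := J.+1%:R^-1; lra.
Qed.

(** * The remainder of the Fourier series in mean square *)

Lemma measurable_log2cos (R : realType) (e : R) (D : set R) :
  measurable_fun D (fun t : R => ln `|cos (e * t)| + ln 2).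
Proof.
apply: measurable_funTS; apply: measurable_funD => //.
apply: (measurableT_comp (@measurable_ln R)).
apply: (measurableT_comp (@normr_measurable R setT)).
by apply: continuous_measurable_fun; exact: continuous_cosM.
Qed.

Lemma measurable_log2cos_poly (R : realType) (J : nat) (e : R) (D : set R) :
  measurable_fun D (fun t : R => log2cos_poly J (e * t)).
Proof.
apply: measurable_funTS; apply: continuous_measurable_fun.
exact: continuous_log2cos_poly.
Qed.

Lemma measurable_weight (R : realType) (T : R) (D : set R) :
  measurable_fun D (@weight R T).
Proof.
apply: measurable_funTS; apply: continuous_measurable_fun.
exact: continuous_weight.
Qed.

Lemma cos_ge_cos1 (R : realType) (x : R) : `|x| <= 1 -> cos 1 <= cos x.
Proof.
move=> x1; rewrite -(cos_norm x).
move: x1; rewrite le_eqVlt => /predU1P[->//|x1].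
have pi2 := @pi_ge2 R.
apply: ltW; rewrite ltr_cos // in_itv /=; apply/andP; split => //; lra.
Qed.

(** The two summands bound the regimes [|e| T > 1] and [|e| T <= 1]. *)
Definition tail_const (R : realType) (T : R) : R :=
  64 * T * (1 + 2 * T ^+ 2) + 8 * T / cos 1 ^+ 4.

Lemma tail_const_ge0 (R : realType) (T : R) : 0 <= T -> 0 <= tail_const T.
Proof.
move=> T0; have c0 : 0 <= cos (1 : R) ^+ 4 by rewrite exprn_even_ge0.
have := sqr_ge0 T; rewrite /tail_const => T2.
apply: addr_ge0; last by apply: divr_ge0 => //; lra.
by apply: mulr_ge0; lra.
Qed.

(** If [|e| T <= 1], the argument [e t] stays in [[-1, 1]], where [cos] is at least [cos 1] and the
    pointwise error bound can be integrated. Otherwise the frequencies are spaced and the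
    trigonometric estimate applies. The constant is the same for all [e]. *)
Lemma log2cos_tail_L2 (R : realType) (T e : R) (J : nat) (D : set R) :
  1 <= T -> measurable D -> D `<=` `[- T, T]%classic ->
  (forall t, D t -> cos (e * t) != 0) ->
  (\int[@lebesgue_measure R]_(t in D)
    (weight T t * (ln `|cos (e * t)| + ln 2 - log2cos_poly J (e * t)) ^+ 2)%:E
   <= (tail_const T / J.+1%:R)%:E)%E.
Proof.
move=> T1 mD DT cD; have T0 : 0 < T by exact: lt_le_trans T1.
have w01 t : D t -> 0 <= weight T t <= 1.
  by move=> /DT tT; exact: (weight_bounds T0).
have c1 := @cos1_gt0 R.
have c4 : 0 < cos (1 : R) ^+ 4 by exact: exprn_gt0.
have J0 : 0 < J.+1%:R :> R by rewrite ltr0n.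
have [eT|eT] := leP (`|e| * T) 1.
  have eb t : D t ->
    weight T t * (ln `|cos (e * t)| + ln 2 - log2cos_poly J (e * t)) ^+ 2 <=
    4 / cos 1 ^+ 4 / J.+1%:R.
    move=> Dt; have /andP[w0 w1] := w01 t Dt.
    have h := log2cos_poly_err J (cD t Dt).
    have cc : cos 1 <= cos (e * t).
      apply: cos_ge_cos1; apply: le_trans eT; rewrite normrM ler_wpM2l //.
      by move: (DT t Dt); rewrite /= in_itv /= -ler_norml.
    set x := ln _ + _ - _ in h *.
    have h1 : `|x| <= 2 / (J.+1%:R * cos 1 ^+ 2).
      apply: (le_trans h); rewrite ler_wpM2l // lef_pV2 ?posrE; last 2 first.
      - by apply: mulr_gt0 => //; apply: exprn_gt0; exact: lt_le_trans cc.
      - by apply: mulr_gt0 => //; exact: exprn_gt0.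
      by rewrite ler_wpM2l ?ler0n // lerXn2r ?nnegrE ?(ltW c1) ?(le_trans (ltW c1)).
    apply: (@le_trans _ _ (1 * (2 / (J.+1%:R * cos 1 ^+ 2)) ^+ 2)).
      apply: ler_pM; rewrite ?sqr_ge0 // -(real_normK (num_real x)).
      by rewrite lerXn2r ?nnegrE // (le_trans _ h1).
    rewrite mul1r.
    (* One of the two factors [1 / (J + 1)] is discarded, to match the rate of the other regime. *)
    rewrite (_ : (2 / _) ^+ 2 = 4 / cos 1 ^+ 4 / J.+1%:R * J.+1%:R^-1); last first.
      have := pnatr_eq0 R J.+1; move: (J.+1%:R) => a /= a0.
      have cn : cos (1 : R) != 0 by rewrite gt_eqF.
      by field; rewrite a0 cn.
    rewrite ler_piMr ?invf_le1 ?ler1n //.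
    by rewrite !divr_ge0 // ?ler0n // ltW.
  have mu2T : (@lebesgue_measure R D <= (2 * T)%:E)%E.
    apply: (@le_trans _ _ (@lebesgue_measure R `[- T, T]%classic)).
      by apply: le_measure; rewrite ?inE.
    rewrite lebesgue_measure_itv /= lte_fin.
    by case: ifP => _; rewrite lee_fin; lra.
  apply: (@le_trans _ _
    (\int[@lebesgue_measure R]_(t in D) (cst (4 / cos 1 ^+ 4 / J.+1%:R)%:E) t)%E).
    apply: ge0_le_integral => //.
    - move=> t /w01/andP[w0 _]; rewrite lee_fin; apply: mulr_ge0 => //; exact: sqr_ge0.
    - apply/measurable_EFinP; apply: measurable_funM; first exact: measurable_weight.
      apply: measurable_funX; apply: measurable_funB; first exact: measurable_log2cos.
      exact: measurable_log2cos_poly.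
  rewrite integral_cst //.
  have k0 : 0 <= 4 / cos 1 ^+ 4 / J.+1%:R :> R by rewrite !divr_ge0 // ?ler0n // ltW.
  apply: (le_trans (lee_wpmul2l _ mu2T)); first by rewrite lee_fin.
  rewrite -EFinM lee_fin mulrAC ler_wpM2r ?invr_ge0 ?ler0n //.
  rewrite /tail_const -[leLHS]add0r; apply: lerD.
    by have := sqr_ge0 T => T2; apply: mulr_ge0; lra.
  by move: (cos 1 ^- 4) => z; lra.
(* With [J] fixed and [M] going to infinity, the partial sums of degree [J + M] converge to the
   logarithm at every point of [D]. *)
apply: (@fatou_bound _ _ (fun M t => weight T t *
  (log2cos_poly (J + M) (e * t) - log2cos_poly J (e * t)) ^+ 2)) => //.
- move=> M; apply: measurable_funM; first exact: measurable_weight.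
  apply: measurable_funX; apply: measurable_funB; exact: measurable_log2cos_poly.
- move=> M t /w01/andP[w0 _]; apply: mulr_ge0 => //; exact: sqr_ge0.
- move=> t Dt; apply: cvgM; first exact: cvg_cst.
  have hc : log2cos_poly (J + M) (e * t) @[M --> \oo] --> ln `|cos (e * t)| + ln 2.
    apply/cvgrPdist_le => eps eps0.
    have ct : 0 < cos (e * t) ^+ 2 by rewrite exprn_even_gt0 // cD.
    near=> M.
    apply: (le_trans (log2cos_poly_err _ (cD t Dt))).
    rewrite ler_pdivrMr; last by apply: mulr_gt0 => //; rewrite ltr0n.
    rewrite mulrCA -ler_pdivrMr; last exact: mulr_gt0.
    apply: (@le_trans _ _ M%:R); last by rewrite ler_nat leqW // leq_addl.
    near: M; exact: nbhs_infty_ger.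
  by apply: cvgM; apply: cvgB => //; exact: cvg_cst.
- move=> M; apply: (@le_trans _ _ (\int[@lebesgue_measure R]_(t in `[(- T)%R, T])
    (weight T t * (log2cos_poly (J + M) (e * t) - log2cos_poly J (e * t)) ^+ 2)%:E)%E).
    apply: ge0_subset_integral => //.
    - apply/measurable_EFinP; apply: measurable_funM; first exact: measurable_weight.
      apply: measurable_funX; apply: measurable_funB; exact: measurable_log2cos_poly.
    - move=> t /= tT; rewrite lee_fin; apply: mulr_ge0; last exact: sqr_ge0.
      by have /andP[] := weight_bounds T0 tT.
  apply: (le_trans (log2cos_tail_L2_trig J M T1 eT)).
  rewrite lee_fin ler_wpM2r ?invr_ge0 ?ler0n // /tail_const lerDl.
  by apply: divr_ge0; [lra | exact: ltW].
Unshelve. all: by end_near. Qed.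

(** * Mean squares of the averages *)

Definition harmonic_sum (R : realType) (J : nat) : R := \sum_(j < J) j.+1%:R^-1.

(** Where no cosine vanishes and [N > 0], this is [ln |r_N(t)| / N + ln 2], so the target limit
    becomes [0]. The shift [i.+1] matches the indexing from 1. *)
Definition log2cos_mean (R : realType) (e : nat -> R) (N : nat) (t : R) : R :=
  N%:R^-1 * \sum_(i < N) (ln `|cos (e i.+1 * t)| + ln 2).

Lemma measurable_log2cos_mean (R : realType) (e : nat -> R) (N : nat) (D : set R) :
  measurable_fun D (log2cos_mean e N).
Proof.
apply: measurable_funM => //; apply: measurable_sum => i.
exact: measurable_log2cos.
Qed.

(** The mean is split as [a + b], remainder plus Fourier polynomial, and
    [(a + b)^2 <= 2 a^2 + 2 b^2]. Cauchy-Schwarz is used with weights [1 / N] on [a] and, after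
    exchanging the sums, with weights [1 / (j + 1)] on [b]; the total of the latter is the harmonic
    sum. *)
Lemma log2cos_mean_sqr_le (R : realType) (e : nat -> R) (N J : nat) (t : R) :
  (0 < N)%N ->
  log2cos_mean e N t ^+ 2 <=
  (\sum_(i < N) 2 / N%:R *
     (ln `|cos (e i.+1 * t)| + ln 2 - log2cos_poly J (e i.+1 * t)) ^+ 2) +
  \sum_(j < J) 2 * harmonic_sum R J / j.+1%:R *
     (\sum_(i < N) N%:R^-1 * cos (j.+1%:R * (2 * e i.+1) * t)) ^+ 2.
Proof.
move=> N0; have NR : 0 < N%:R :> R by rewrite ltr0n.
pose f i := ln `|cos (e i.+1 * t)| + ln 2.
pose q i := log2cos_poly J (e i.+1 * t).
pose a := \sum_(i < N) N%:R^-1 * (f i - q i).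
pose b := \sum_(i < N) N%:R^-1 * q i.
have -> : log2cos_mean e N t = a + b.
  rewrite /log2cos_mean mulr_sumr /a /b -big_split /=.
  by apply: eq_bigr => i _; rewrite -mulrDr subrK.
have bE : b = \sum_(j < J) j.+1%:R^-1 *
   ((-1) ^+ j * \sum_(i < N) N%:R^-1 * cos (j.+1%:R * (2 * e i.+1) * t)).
  rewrite /b /q /log2cos_poly.
  under eq_bigr do rewrite mulr_sumr.
  rewrite exchange_big /=; apply: eq_bigr => j _.
  rewrite mulrA mulr_sumr; apply: eq_bigr => i _.
  by rewrite !mulrA [_^-1 * (-1) ^+ j]mulrC; ring.
have ha : a ^+ 2 <= \sum_(i < N) N%:R^-1 * (f i - q i) ^+ 2.
  apply: (le_trans (sqr_wsum_le _ _ _)); first by move=> i; rewrite invr_ge0 ltW.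
  rewrite sumr_const card_ord -[_ *+ N]mulr_natl divff ?mul1r //.
  by rewrite gt_eqF.
have hb : b ^+ 2 <= harmonic_sum R J * \sum_(j < J) j.+1%:R^-1 *
    (\sum_(i < N) N%:R^-1 * cos (j.+1%:R * (2 * e i.+1) * t)) ^+ 2.
  rewrite bE; apply: (le_trans (sqr_wsum_le _ _ _)).
    by move=> i; rewrite invr_ge0 ler0n.
  by under [X in _ * X <= _]eq_bigr do rewrite exprMn sqrr_sign mul1r.
apply: (@le_trans _ _ (2 * a ^+ 2 + 2 * b ^+ 2)).
  by have := sqr_ge0 (a - b); lra.
apply: lerD.
  apply: (le_trans (ler_wpM2l _ ha)) => //.
  by rewrite mulr_sumr; apply: ler_sum => i _; rewrite mulrA.
apply: (le_trans (ler_wpM2l _ hb)) => //.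
by rewrite mulrA mulr_sumr; apply: ler_sum => i _; rewrite mulrA.
Qed.

(** The factor [2 (j + 1)] only spreads the frequencies [e i.+1] further apart, so one counting
    bound for [e] serves every [j]. *)
Lemma cos_mean_L2 (R : realType) (T d K : R) (e : nat -> R) (N j : nat) :
  1 <= T -> 0 < d -> (0 < N)%N ->
  (forall y : R, #|[set i : 'I_N | y <= e i.+1 <= y + d]%SET|%:R <= K) ->
  (\int[@lebesgue_measure R]_(t in `[(- T)%R, T])
    (weight T t * (\sum_(i < N) N%:R^-1 * cos (j.+1%:R * (2 * e i.+1) * t)) ^+ 2)%:E
   <= (32 * T * (1 + 2 / d ^+ 2) * (K / N%:R))%:E)%E.
Proof.
move=> T1 d0 N0 hK; have T0 : 0 < T by exact: lt_le_trans T1.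
have NR : 0 < N%:R :> R by rewrite ltr0n.
apply: (le_trans (weighted_cos_sum_L2 _ _ T1)); rewrite lee_fin.
apply: (@le_trans _ _ (\sum_(i < N) N%:R^-1 ^+ 2 *
    (16 * T * (2 * K * (1 + 2 / d ^+ 2))))).
  apply: ler_sum => i _; apply: ler_wpM2l; first exact: sqr_ge0.
  apply: (le_trans _ (ler_wpM2l _ (sum_bins_le (e i.+1) d0 hK))); last by lra.
  rewrite mulr_sumr; apply: ler_sum => k _; apply: ler_wpM2l; first by lra.
  rewrite lef_pV2 ?posrE ?ltr_wpDr ?sqr_ge0 // lerD2l.
  rewrite -mulrBr exprMn -mulrBr exprMn mulrA ler_peMl ?sqr_ge0 //.
  have : 1 <= j.+1%:R :> R by rewrite ler1n.
  by rewrite !expr2; nra.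
rewrite sumr_const card_ord -[_ *+ N]mulr_natl.
rewrite le_eqVlt; apply/orP; left; apply/eqP.
field; by rewrite !gt_eqF.
Qed.

Lemma log2cos_mean_L2 (R : realType) (T d K : R) (e : nat -> R) (N J : nat)
    (D : set R) :
  1 <= T -> 0 < d -> (0 < N)%N -> measurable D -> D `<=` `[- T, T]%classic ->
  (forall n t, (0 < n)%N -> D t -> cos (e n * t) != 0) ->
  (forall y : R, #|[set i : 'I_N | y <= e i.+1 <= y + d]%SET|%:R <= K) ->
  (\int[@lebesgue_measure R]_(t in D) (weight T t * log2cos_mean e N t ^+ 2)%:E
   <= (2 * tail_const T / J.+1%:R +
       2 * harmonic_sum R J ^+ 2 * (32 * T * (1 + 2 / d ^+ 2) * (K / N%:R)))%:E)%E.
Proof.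
move=> T1 d0 N0 mD DT cD hK; have T0 : 0 < T by exact: lt_le_trans T1.
have NR : 0 < N%:R :> R by rewrite ltr0n.
have w0 t : D t -> 0 <= weight T t.
  by move=> /DT tT; have /andP[] := weight_bounds T0 tT.
have H0 : 0 <= harmonic_sum R J by apply: sumr_ge0 => j _; rewrite invr_ge0.
(* The disjoint sum merges the two families of squares into a single weighted sum, integrated term
   by term. *)
pose k (s : 'I_N + 'I_J) : R := match s with
  | inl i => 2 / N%:R | inr j => 2 * harmonic_sum R J / j.+1%:R end.
pose g (s : 'I_N + 'I_J) (t : R) : R := weight T t * match s with
  | inl i => (ln `|cos (e i.+1 * t)| + ln 2 - log2cos_poly J (e i.+1 * t)) ^+ 2
  | inr j => (\sum_(i < N) N%:R^-1 * cos (j.+1%:R * (2 * e i.+1) * t)) ^+ 2 end.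
pose B (s : 'I_N + 'I_J) : R := match s with
  | inl i => tail_const T / J.+1%:R
  | inr j => 32 * T * (1 + 2 / d ^+ 2) * (K / N%:R) end.
have g0 s t : D t -> 0 <= g s t.
  by move=> Dt; apply: mulr_ge0; [exact: w0|case: s => i; exact: sqr_ge0].
have mg (D' : set R) s : measurable_fun D' (g s).
  apply: measurable_funM; first exact: measurable_weight.
  case: s => i; apply: measurable_funX.
    apply: measurable_funB; first exact: measurable_log2cos.
    exact: measurable_log2cos_poly.
  apply: measurable_funTS; apply: continuous_measurable_fun.
  exact: continuous_cos_sum.
apply: (@le_trans _ _ (\int[@lebesgue_measure R]_(t in D) (\sum_s k s * g s t)%:E)%E).
  apply: ge0_le_integral => //.
  - by move=> t Dt; rewrite lee_fin; apply: mulr_ge0; [exact: w0|exact: sqr_ge0].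
  - apply/measurable_EFinP; apply: measurable_funM; first exact: measurable_weight.
    by apply: measurable_funX; exact: measurable_log2cos_mean.
  - apply/measurable_EFinP; apply: measurable_sum => s.
    by apply: measurable_funM => //; exact: mg.
  - move=> t Dt; rewrite lee_fin big_sumType /=.
    apply: (le_trans (ler_wpM2l (w0 t Dt) (log2cos_mean_sqr_le e J t N0))).
    rewrite mulrDr !mulr_sumr; apply: lerD; apply: ler_sum => i _;
      by rewrite mulrCA.
apply: (le_trans (integral_wsum_le (B := B) _ mD _ _ _ _)).
- by case=> i; rewrite /k !(mulr_ge0, invr_ge0, ler0n).
- by move=> s; exact: mg.
- exact: g0.
- case=> [i|j]; first by apply: log2cos_tail_L2 => // t; exact: cD.
  apply: (le_trans _ (cos_mean_L2 j T1 d0 N0 hK)).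
  apply: ge0_subset_integral => //.
    by apply/measurable_EFinP; exact: (mg _ (inr j)).
  move=> t /= tT; rewrite lee_fin; apply: mulr_ge0; last exact: sqr_ge0.
  by have /andP[] := weight_bounds T0 tT.
rewrite lee_fin big_sumType /= sumr_const card_ord -[_ *+ N]mulr_natl.
apply: lerD.
  rewrite le_eqVlt; apply/orP; left; apply/eqP.
  have := pnatr_eq0 R J.+1; move: (J.+1%:R) => a /= a0.
  have Nn : N%:R != 0 :> R by rewrite gt_eqF.
  by field; rewrite a0 Nn.
rewrite -mulr_suml -mulr_sumr -/(harmonic_sum R J) expr2.
by rewrite le_eqVlt; apply/orP; left; apply/eqP; ring.
Qed.

(** * Counting under the growth condition *)

Lemma card_window (N m q : nat) (A : {set 'I_N}) :
  (forall i, i \in A -> (i <= m)%N /\ (m - i <= q)%N) -> (#|A| <= q.+1)%N.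
Proof.
move=> hA; pose f (i : 'I_N) : 'I_q.+1 := inord (m - i).
have finj : {in A &, injective f}.
  move=> i j Ai Aj /(congr1 (@nat_of_ord _)).
  have [im iq] := hA i Ai; have [jm jq] := hA j Aj.
  rewrite !inordK ?ltnS // => E; apply: val_inj => /=.
  by rewrite -(subKn im) E subKn.
by rewrite -(card_in_imset finj) (leq_trans (max_card _)) ?card_ord.
Qed.

(* The growth condition is applied at the largest index [n] of the window only:
   if [ln n <= ln N / 2] the window has at most [sqrt N] elements anyway. *)
Lemma weyl_count (R : realType) (e : nat -> R) (a d : R) (N : nat) (y : R) :
  0 < a -> (1 < N)%N ->
  (forall n m : nat, (2 <= n)%N -> (1 <= m)%N ->
      `|n%:R - m%:R| > n%:R / (ln (n%:R : R)) `^ a -> `|e n - e m| > d) ->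
  #|[set i : 'I_N | y <= e i.+1 <= y + d]%SET|%:R <=
    1 + expR (ln N%:R / 2) + N%:R / (ln N%:R / 2) `^ a.
Proof.
move=> a0 N1 hw; set A := [set i | _]%SET.
have N0 : 0 < N%:R :> R by rewrite ltr0n ltnW.
have L0 : 0 < ln (N%:R : R) by rewrite ln_gt0 // ltr1n.
have X0 : 0 <= N%:R / (ln N%:R / 2) `^ a :> R by rewrite divr_ge0 ?ler0n ?powR_ge0.
have E0 := expR_ge0 (ln (N%:R : R) / 2).
have [->|[i0 Ai0]] := set_0Vmem A; first by rewrite cards0; lra.
pose m := [arg max_(i > i0 in A) (i : nat)].
have [Am mmax] : m \in A /\ forall i, i \in A -> (i <= m)%N.
  by rewrite /m; case: arg_maxnP => // j Aj h; split.
have n0 : 0 < m.+1%:R :> R by rewrite ltr0n.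
have [h|h] := leP (ln (m.+1%:R : R)) (ln N%:R / 2).
  have /(leq_trans _)hc : (#|A| <= m.+1)%N.
    by apply: card_window => i Ai; split; [exact: mmax|rewrite leq_subr].
  apply: (@le_trans _ _ m.+1%:R); first by rewrite ler_nat hc.
  by have := h; rewrite -ler_expR lnK ?posrE //; lra.
have lm0 : 0 < ln (m.+1%:R : R) by lra.
have m1 : (1 < m.+1)%N.
  by rewrite ltnNge; apply/negP => h1; move: lm0; rewrite ltNge ln_le0 // lern1.
pose X := m.+1%:R / ln (m.+1%:R : R) `^ a.
have X1 : 0 <= X by rewrite /X divr_ge0 ?ler0n ?powR_ge0.
(* A larger index gap would force [e m.+1] and [e i.+1] more than [d] apart, yet both lie in a
   window of length [d]. *)
have hX i : i \in A -> (m - i)%N%:R <= X.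
  move=> Ai; have im := mmax i Ai.
  have := @hw m.+1 i.+1 m1 isT.
  rewrite -natrB ?ltnS // subSS (ger0_norm (ler0n _ _)) -/X => hwi.
  rewrite leNgt; apply/negP => /hwi; apply/negP; rewrite -leNgt.
  move: Am Ai; rewrite !inE => /andP[h1 h2] /andP[h3 h4].
  by rewrite ler_norml; apply/andP; split; lra.
have hc : (#|A| <= (Num.truncn X).+1)%N.
  apply: (@card_window _ m) => i Ai; split; first exact: mmax.
  by rewrite truncn_ge_nat // hX.
have XX : X <= N%:R / (ln N%:R / 2) `^ a.
  apply: ler_pM; rewrite ?ler0n ?invr_ge0 ?powR_ge0 ?ler_nat //.
  have p1 : 0 < (ln N%:R / 2) `^ a :> R by rewrite powR_gt0 // divr_gt0.
  have pp : (ln N%:R / 2) `^ a <= ln (m.+1%:R : R) `^ a.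
    by rewrite ge0_ler_powR ?nnegrE ?(ltW a0) ?(ltW h) ?(ltW lm0) ?divr_ge0 ?(ltW L0).
  by rewrite lef_pV2 ?posrE // (lt_le_trans p1 pp).
have := truncn_le X; rewrite X1 => hT.
have : #|A|%:R <= (Num.truncn X).+1%:R :> R by rewrite ler_nat.
by rewrite -natr1; lra.
Qed.

(** One Taylor term of the exponential, of integer order at least [a], dominates the power. At
    [x = ln N] it compares [(ln N)^a] with the square root of [N]. *)
Lemma powR_le_expR_half (R : realType) (a : R) : 0 <= a ->
  exists2 C : R, 0 < C & forall x : R, 0 < x -> x `^ a <= C * expR (x / 2).
Proof.
move=> a0; pose q := Num.truncn `|a|.
have aq : a <= q.+1%:R by rewrite (le_trans (ler_norm _)) // ltW // truncnS_gt.
have f0 : 0 < (q.+1)`!%:R :> R by rewrite ltr0n fact_gt0.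
have f1 : 0 < 2 ^+ q.+1 * (q.+1)`!%:R :> R by rewrite mulr_gt0 // exprn_gt0.
exists (1 + 2 ^+ q.+1 * (q.+1)`!%:R); first by lra.
move=> x x0; have E1 : 1 <= expR (x / 2) by have := expR_ge1Dx (x / 2); lra.
have h : x ^+ q.+1 <= 2 ^+ q.+1 * (q.+1)`!%:R * expR (x / 2).
  have : 0 <= x / 2 by lra.
  move/(expR_ge1Dxn q) => h.
  have : (x / 2) ^+ q.+1 / (q.+1)`!%:R <= expR (x / 2) by lra.
  rewrite ler_pdivrMr // expr_div_n ler_pdivrMr ?exprn_gt0 //; lra.
rewrite mulrDl mul1r; have [x1|x1] := leP x 1.
  apply: (@le_trans _ _ 1); last by have := mulr_ge0 (ltW f1) (expR_ge0 (x / 2)); lra.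
  have e1 : 1 `^ a = 1 :> R by rewrite powR1.
  by rewrite -[leRHS]e1 ge0_ler_powR ?nnegrE // ltW.
apply: (@le_trans _ _ (x ^+ q.+1)); last by lra.
by rewrite -powR_mulrn ?(ltW x0) // ler_powR // ltW.
Qed.

(** Here [expR (ln N / 2)] is the square root [E] of [N]; the terms [1 + E] contribute at most
    [2 / E] after division by [N], which the previous lemma absorbs. *)
Lemma weyl_density (R : realType) (a : R) : 0 < a ->
  exists2 C : R, 0 < C & forall N : nat, (1 < N)%N ->
   (1 + expR (ln N%:R / 2) + N%:R / (ln N%:R / 2) `^ a) / N%:R <=
   C / (ln N%:R) `^ a.
Proof.
move=> a0; have [C C0 hC] := powR_le_expR_half (ltW a0).
have p2 : 0 < 2 `^ a :> R by rewrite powR_gt0.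
exists (2 * C + 2 `^ a); first by lra.
move=> N N1; have N0 : 0 < N%:R :> R by rewrite ltr0n ltnW.
have L0 : 0 < ln (N%:R : R) by rewrite ln_gt0 // ltr1n.
have := hC _ L0; set L := ln N%:R in L0 *.
have NE : N%:R = expR (L / 2) * expR (L / 2) by rewrite -expRD -splitr lnK.
have E1 : 1 <= expR (L / 2) by have := expR_ge1Dx (L / 2); lra.
have La : 0 < L `^ a by rewrite powR_gt0.
have -> : (L / 2) `^ a = L `^ a / 2 `^ a.
  by rewrite powRM ?invr_ge0 ?(ltW L0) // -powR_inv1 // -powRrM mulN1r powRN.
rewrite NE; move: (expR (L / 2)) E1 (L `^ a) La => E E1 P P0 hP.
have E0 : 0 < E by lra.
rewrite ler_pdivrMr ?mulr_gt0 //.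
rewrite [leRHS]mulrAC ler_pdivlMr //.
have -> : (1 + E + E * E / (P / 2 `^ a)) * P = (1 + E) * P + 2 `^ a * (E * E).
  by field; rewrite !gt_eqF.
rewrite [leRHS]mulrDl lerD2r.
apply: (@le_trans _ _ (2 * E * (C * E))); last by lra.
by apply: ler_pM => //; lra.
Qed.

(** * Interpolation between blocks *)

(** An integer substitute for a geometric sequence of ratio [1 + 1 / (p + 1)]. The successor forces
    strict growth, and the start at 2 keeps [ln] positive. *)
Fixpoint block (p k : nat) : nat :=
  if k is k'.+1 then (block p k' + block p k' %/ p.+1).+1 else 2.

Lemma block_gt1 (p k : nat) : (1 < block p k)%N.
Proof. by elim: k => //= k IH; rewrite ltnS (leq_trans (ltnW IH)) ?leq_addr. Qed.

Lemma block_lt (p k : nat) : (block p k < block p k.+1)%N.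
Proof. by rewrite /= ltnS leq_addr. Qed.

Lemma block_le (p : nat) : {homo block p : j k / (j <= k)%N}.
Proof.
by apply: homo_leq => //; [exact: leq_trans|move=> k; exact: ltnW (block_lt p k)].
Qed.

Lemma block_gt_id (p k : nat) : (k < block p k)%N.
Proof. by elim: k => // k IH; exact: leq_ltn_trans IH (block_lt p k). Qed.

Lemma block_locate (p n : nat) : (1 < n)%N ->
  exists k, (block p k <= n < block p k.+1)%N.
Proof.
move=> n1; have ex0 : exists k, (block p k <= n)%N by exists 0%N.
have bnd k : (block p k <= n)%N -> (k <= n)%N.
  by move=> h; apply: leq_trans h; exact: ltnW (block_gt_id p k).
case: (ex_maxnP ex0 bnd) => k hk kmax; exists k; rewrite hk andTb ltnNge.
by apply/negP => h; have := kmax _ h; rewrite ltnn.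
Qed.

Lemma block_growth (R : realType) (p k : nat) :
  (1 + p.+1%:R^-1) ^+ k.+1 <= (block p k)%:R :> R.
Proof.
have p0 : 0 < p.+1%:R :> R by rewrite ltr0n.
elim: k => [|k IH].
  by rewrite expr1 /= [leRHS]mulr2n lerD2l invf_le1 // ler1n.
rewrite exprS; apply: (@le_trans _ _ ((1 + p.+1%:R^-1) * (block p k)%:R)).
  by apply: ler_wpM2l => //; rewrite addr_ge0 // invr_ge0 ltW.
rewrite [block _ _.+1]/= -addnS natrD mulrDl mul1r lerD2l mulrC.
rewrite ler_pdivrMr // -natrM ler_nat ltnW //.
by rewrite ltn_ceil.
Qed.

Lemma block_step (R : realType) (p k : nat) :
  (block p k.+1)%:R <= (block p k)%:R + (block p k)%:R / p.+1%:R + 1 :> R.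
Proof.
have p0 : 0 < p.+1%:R :> R by rewrite ltr0n.
rewrite [block _ _.+1]/= -natr1 natrD lerD2r lerD2l.
by rewrite ler_pdivlMr // -natrM ler_nat leq_divM.
Qed.

(** A bound from above on the terms suffices: for [n] between two block ends, the sum up to [n] is
    bounded above from the left end and below from the right end, since from there to the right end
    it rises by at most [b] per term. *)
Lemma mean_cvg0_of_blocks (R : realType) (x : nat -> R) (b : R) : 0 <= b ->
  (forall n, x n <= b) ->
  (forall p, (block p k)%:R^-1 * (\sum_(i < block p k) x i) @[k --> \oo] --> 0) ->
  n%:R^-1 * (\sum_(i < n) x i) @[n --> \oo] --> 0.
Proof.
move=> b0 xb hp.
have inc m n : (m <= n)%N ->
    \sum_(i < n) x i <= \sum_(i < m) x i + (n%:R - m%:R) * b.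
  move=> mn; rewrite -(subnKC mn) big_split_ord /= lerD2l natrD addrC addKr.
  apply: (@le_trans _ _ (\sum_(i < n - m) b)); first by apply: ler_sum.
  by rewrite sumr_const card_ord mulr_natl.
apply/cvgrPdist_le => /= eps eps0.
(* A block has about [n / (p + 1)] terms, so it moves the sum by at most [n eps / 4]; the rounding
   in the block length costs [b], again at most [n eps / 4] for large [n]. *)
pose p := Num.truncn (4 * b / eps).
have pb : b / p.+1%:R <= eps / 4.
  have := truncnS_gt (4 * b / eps); rewrite -/p ltr_pdivrMr // => h.
  by rewrite ler_pdivrMr ?ltr0n //; move: (p.+1%:R) h => q h; lra.
(* The right end is at most [3 n], so it costs [3 eps / 8], and [3 / 8 + 1 / 2 < 1]. *)
have e8 : 0 < eps / 8 by lra.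
move/cvgrPdist_le : (hp p) => /(_ _ e8)[k0 _ hk0].
near=> n.
have n1 : (1 < n)%N by near: n; exact: nbhs_infty_gt.
have nk0 : (block p k0 <= n)%N by near: n; exact: nbhs_infty_ge.
have nb : 4 * b / eps <= n%:R by near: n; exact: nbhs_infty_ger.
have [k /andP[kn nk]] := block_locate p n1.
have kk0 : (k0 <= k)%N.
  rewrite leqNgt; apply/negP => /(block_le p) h.
  by move: nk; rewrite ltnNge (leq_trans h nk0).
have blk j : (k0 <= j)%N ->
    `|\sum_(i < block p j) x i| <= eps / 8 * (block p j)%:R.
  move=> /hk0 /=; rewrite sub0r normrN normrM normfV (ger0_norm (ler0n _ _)) mulrC.
  by rewrite ler_pdivrMr // ltr0n (ltn_trans _ (block_gt1 p j)).
have /ler_normlP[_ u1] := blk k kk0.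
have /ler_normlP[l1 _] := blk k.+1 (leqW kk0).
have s1 := inc _ _ kn; have s2 := inc _ _ (ltnW nk).
have st := block_step R p k.
have n0 : 0 < n%:R :> R by rewrite ltr0n (ltn_trans _ n1).
rewrite sub0r normrN normrM normfV (ger0_norm (ler0n _ _)) mulrC ler_pdivrMr //.
have knR : (block p k)%:R <= n%:R :> R by rewrite ler_nat.
have nkR : n%:R <= (block p k.+1)%:R :> R by rewrite ler_nat ltnW.
move: st knR nkR l1 u1 s1 s2 pb nb n0 {blk hk0}.
have n2 : 2 <= n%:R :> R by rewrite ler_nat.
have q1 : 1 <= p.+1%:R :> R by rewrite ler1n.
have B0 : 0 <= (block p k)%:R :> R by [].
move: (\sum_(i < n) x i) (\sum_(i < block p k) x i) (\sum_(i < block p k.+1) x i).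
move: (block p k)%:R (block p k.+1)%:R n%:R n2 p.+1%:R q1 B0.
move=> Nk Nk1 n' n2 q q1 B0 S Sk Sk1 st knR nkR l1 u1 s1 s2 pb nb n0.
have q0 : 0 < q by lra.
have gap : (Nk1 - Nk) * b <= n' * (eps / 2).
  apply: (@le_trans _ _ ((Nk / q + 1) * b)); first by rewrite ler_wpM2r //; lra.
  rewrite mulrDl mul1r mulrAC -mulrA.
  have : Nk * (b / q) <= n' * (eps / 4).
    by apply: ler_pM => //; rewrite divr_ge0 // ltW.
  by move: nb; rewrite ler_pdivrMr //; lra.
have gap1 : (n' - Nk) * b <= n' * (eps / 2).
  by apply: le_trans gap; rewrite ler_wpM2r //; lra.
have gap2 : (Nk1 - n') * b <= n' * (eps / 2).
  by apply: le_trans gap; rewrite ler_wpM2r //; lra.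
have Nk3 : Nk1 <= 3 * n'.
  have : Nk / q <= Nk by rewrite ler_pdivrMr // ler_peMr.
  by lra.
have h1 : eps / 8 * Nk <= eps / 8 * n' by rewrite ler_wpM2l // ltW.
have h2 : eps / 8 * Nk1 <= eps / 8 * (3 * n') by rewrite ler_wpM2l // ltW.
have en : 0 < eps * n' by rewrite mulr_gt0.
by rewrite ler_norml; apply/andP; split; lra.
Unshelve. all: by end_near. Qed.

(** * Estimates for power series sums and harmonic sums *)

Lemma sum_powR_le (R : realType) (a : R) (n : nat) : 0 < a ->
  \sum_(k < n) (k.+1%:R `^ (1 + a))^-1 <= 1 + a^-1 :> R.
Proof.
move=> a0.
(* Telescoping in place of the integral test: [y^(-1-a) <= (x^(-a) - y^(-a)) / a] when
   [y = x + 1]. *)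
suff h m : \sum_(k < m.+1) (k.+1%:R `^ (1 + a))^-1 <=
    1 + a^-1 * (1 - (m.+1%:R `^ a)^-1) :> R.
  case: n => [|n]; first by rewrite big_ord0 addr_ge0 // invr_ge0 ltW.
  apply: (le_trans (h n)); rewrite lerD2l.
  apply: ler_piMr; first by rewrite invr_ge0 ltW.
  by rewrite gerBl invr_ge0 powR_ge0.
elim: m => [|m IH]; first by rewrite big_ord1 !powR1 invr1 subrr mulr0 addr0.
rewrite big_ord_recr /=; apply: (le_trans (lerD IH (lexx _))).
rewrite -addrA lerD2l -lerBrDl -mulrBr.
rewrite (_ : 1 - _ - (1 - _) = (m.+1%:R `^ a)^-1 - (m.+2%:R `^ a)^-1); last by ring.
set x : R := m.+1%:R; set y : R := m.+2%:R.
have x0 : 0 < x by rewrite ltr0n.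
have y0 : 0 < y by rewrite ltr0n.
have yx : y = x + 1 by rewrite /y -natr1.
have yn : y != 0 by rewrite gt_eqF.
rewrite powRD ?yn ?implybT // powRr1 ?(ltW y0) //.
have ya : 0 < y `^ a by rewrite powR_gt0.
have xa : 0 < x `^ a by rewrite powR_gt0.
(* [(y/x)^a >= 1 - a ln (x/y) >= 1 + a/y] *)
have key : (1 + a / y) * (y `^ a)^-1 <= (x `^ a)^-1.
  have z0 : 0 < x / y by rewrite divr_gt0.
  have zl : ln (x / y) <= - y^-1.
    have -> : x / y = 1 + - y^-1.
      by rewrite (_ : x = y - 1) ?mulrBl ?divff ?mul1r // yx addrK.
    apply: le_ln1Dx; rewrite ltrN2 invf_lt1 // /y ltr1n //.
  have h : 1 + a / y <= (x / y) `^ (- a).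
    rewrite -[(x / y) `^ _]lnK ?posrE ?powR_gt0 // ln_powR.
    apply: le_trans (expR_ge1Dx _); rewrite lerD2l mulNr -mulrN.
    by rewrite ler_wpM2l ?(ltW a0) // lerNr.
  move: h; rewrite powRN powRM ?invr_ge0 ?(ltW x0) ?(ltW y0) //.
  have -> : y^-1 `^ a = (y `^ a)^-1.
    by rewrite -powR_inv1 ?(ltW y0) // -powRrM mulN1r powRN.
  rewrite invfM invrK => h.
  by rewrite -ler_pdivlMr ?invr_gt0 // invrK.
rewrite ler_pdivlMl // invfM; move: key; rewrite mulrDl mul1r.
by move: (y `^ a)^-1 (x `^ a)^-1 (y^-1) => Y X z h; lra.
Qed.

(** Each new term satisfies [1 / y <= - ln (1 - 1 / y) = ln y - ln (y - 1)]. *)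
Lemma harmonic_sum_le (R : realType) (J : nat) :
  harmonic_sum R J.+1 <= 1 + ln J.+1%:R.
Proof.
rewrite /harmonic_sum; elim: J => [|J IH]; first by rewrite big_ord1 ln1 invr1 addr0.
rewrite big_ord_recr /=; apply: (le_trans (lerD IH (lexx _))); rewrite -addrA lerD2l.
set x : R := J.+1%:R; set y : R := J.+2%:R.
have x0 : 0 < x by rewrite ltr0n.
have y0 : 0 < y by rewrite ltr0n.
have yx : x = y - 1 by rewrite /x /y -[J.+2%:R]natr1 addrK.
have -> : x = y * (1 + - y^-1) by rewrite mulrDr mulrN divff ?gt_eqF // mulr1.
have y1 : -1 < - y^-1 by rewrite ltrN2 invf_lt1 // ltr1n.
rewrite lnM ?posrE //; last by move: y1; move: (y^-1) => z; lra.
by have := le_ln1Dx y1; move: (y^-1) (ln y) => z u; lra.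
Qed.

(** * Summability and almost everywhere convergence *)

Lemma powR_log_le (R : realType) (a x : R) : 0 < a -> 1 <= x ->
  1 + 2 * ln x <= (1 + 2 / a) * x `^ a.
Proof.
move=> a0 x1; have x0 : 0 < x by lra.
have h : 1 + a * ln x <= x `^ a.
  by rewrite -[x `^ a]lnK ?posrE ?powR_gt0 // ln_powR expR_ge1Dx.
have l0 := ln_ge0 x1.
have P1 : 1 <= x `^ a by have := mulr_ge0 (ltW a0) l0; lra.
have : 2 * ln x <= 2 / a * x `^ a by rewrite mulrAC ler_pdivlMr //; lra.
by rewrite mulrDl mul1r; lra.
Qed.

(** The degree [(k + 1)^2] makes the Fourier remainder summable in [k], while the harmonic sum stays
    logarithmic and costs only an arbitrarily small power. *)
Lemma harmonic_sum_sqr_le (R : realType) (a : R) (k : nat) : 0 < a ->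
  harmonic_sum R (k.+1 ^ 2) <= (1 + 2 / a) * k.+1%:R `^ a.
Proof.
move=> a0; have x1 : 1 <= k.+1%:R :> R by rewrite ler1n.
apply: le_trans (powR_log_le a0 x1).
have kk : (0 < k.+1 ^ 2)%N by rewrite expn_gt0.
rewrite -(prednK kk); apply: (le_trans (harmonic_sum_le _ _)).
by rewrite (prednK kk) natrX lnXn ?ltr0n // lerD2l mulr_natl.
Qed.

(** Block ends grow exponentially, so [ln (block p k)] is at least a multiple of [k + 1] and
    logarithmic decay in [N] becomes power decay in [k]. *)
Lemma weyl_block_density (R : realType) (a : R) (p : nat) : 0 < a ->
  exists2 C : R, 0 < C & forall k : nat,
   (1 + expR (ln (block p k)%:R / 2) +
      (block p k)%:R / (ln (block p k)%:R / 2) `^ a) / (block p k)%:R <=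
   C / k.+1%:R `^ a.
Proof.
move=> a0; have [C C0 hC] := weyl_density a0.
pose c : R := ln (1 + p.+1%:R^-1).
have p1 : 1 < 1 + p.+1%:R^-1 :> R by rewrite ltrDl invr_gt0 ltr0n.
have c0 : 0 < c by rewrite ln_gt0.
have ca : 0 < c `^ a by rewrite powR_gt0.
exists (C / c `^ a); first by rewrite divr_gt0.
move=> k; set N := block p k; have N1 : (1 < N)%N by exact: block_gt1.
apply: (le_trans (hC N N1)); rewrite -mulrA ler_wpM2l ?(ltW C0) // -invfM.
have k0 : 0 < k.+1%:R :> R by rewrite ltr0n.
have kc : c * k.+1%:R <= ln N%:R.
  have p0 := lt_trans ltr01 p1.
  rewrite mulr_natr /c -lnXn // ler_ln ?posrE; first exact: block_growth.
    exact: exprn_gt0.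
  by rewrite ltr0n ltnW.
have kc0 : 0 < c * k.+1%:R by rewrite mulr_gt0.
rewrite -powRM ?(ltW c0) ?(ltW k0) // lef_pV2 ?posrE ?powR_gt0 //.
  by rewrite ge0_ler_powR ?nnegrE ?(ltW a0) ?(ltW kc0) // (le_trans (ltW kc0)).
exact: lt_le_trans kc.
Qed.

Lemma block_mean_L2_summable (R : realType) (e : nat -> R) (p : nat) (T : R)
    (D : set R) : weyl_growth e ->
  1 <= T -> measurable D -> D `<=` `[- T, T]%classic ->
  (forall n t, (0 < n)%N -> D t -> cos (e n * t) != 0) ->
  exists beta : nat -> R, exists B : R,
   (forall k, (\int[@lebesgue_measure R]_(t in D)
     (weight T t * log2cos_mean e (block p k) t ^+ 2)%:E <= (beta k)%:E)%E) /\
   forall n, \sum_(k < n) beta k <= B.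
Proof.
move=> [eps [d [eps0 [d0 hw]]]] T1 mD DT cD.
have T0 : 0 < T by exact: lt_le_trans T1.
have a0 : 0 < 1 + eps by lra.
have [C C0 hC] := weyl_block_density p a0.
pose M := 32 * T * (1 + 2 / d ^+ 2) * C.
have d2 : 0 <= 2 / d ^+ 2 by apply: divr_ge0 => //; exact: sqr_ge0.
have M0 : 0 <= M.
  by apply: mulr_ge0; [apply: mulr_ge0; lra|exact: ltW].
pose G := 2 * (1 + 2 / (eps / 4)) ^+ 2 * M.
(* The density gives the exponent [- (1 + eps)]; the squared harmonic sum, with exponent [eps / 4]
   per factor, gives back [eps / 2]. What remains is still summable. *)
pose beta k := 2 * tail_const T * k.+1%:R ^- 2 +
   G * (k.+1%:R `^ (1 + eps / 2))^-1.
have tc0 := tail_const_ge0 (ltW T0).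
have G0 : 0 <= G by apply: mulr_ge0 => //; apply: mulr_ge0 => //; exact: sqr_ge0.
exists beta, (2 * tail_const T * 2 + G * (1 + (eps / 2)^-1)); split; last first.
  move=> n; rewrite big_split /= -!mulr_sumr; apply: lerD.
    apply: ler_wpM2l; first by lra.
    by apply: (le_trans (sum_tail_inv_sqr R 0 n)); rewrite divr1.
  by apply: ler_wpM2l => //; apply: sum_powR_le; lra.
move=> k; set N := block p k; have N1 : (1 < N)%N by exact: block_gt1.
have hK := fun y => weyl_count y a0 N1 hw.
apply: (le_trans (log2cos_mean_L2 (k.+1 ^ 2) T1 d0 (ltnW N1) mD DT cD hK)).
have k1 : 1 <= k.+1%:R :> R by rewrite ler1n.
have k0 : 0 < k.+1%:R :> R by rewrite ltr0n.
rewrite lee_fin /beta; apply: lerD.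
  apply: ler_wpM2l; first by lra.
  have kk : 0 < k.+1%:R ^+ 2 :> R by exact: exprn_gt0.
  by rewrite lef_pV2 ?posrE ?ltr0n // -natrX ler_nat leqnSn.
have e4 : 0 < eps / 4 by lra.
have hH := @harmonic_sum_sqr_le R (eps / 4) k e4.
have H0 : 0 <= harmonic_sum R (k.+1 ^ 2).
  by apply: sumr_ge0 => j _; rewrite invr_ge0.
set x : R := k.+1%:R in k0 k1 hH *.
set A := 1 + 2 / (eps / 4) in hH *.
have xn : x != 0 by rewrite gt_eqF.
have hH2 : harmonic_sum R (k.+1 ^ 2) ^+ 2 <= A ^+ 2 * x `^ (eps / 2).
  have -> : x `^ (eps / 2) = (x `^ (eps / 4)) ^+ 2.
    by rewrite -powR_mulrn ?powR_ge0 // -powRrM; congr (_ `^ _); field.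
  by rewrite -exprMn lerXn2r ?nnegrE // (le_trans H0).
have := hC k; rewrite /= -/N -/x => hCk.
set Q := (_ / N%:R) in hCk *.
have Q0 : 0 <= Q.
  rewrite /Q; apply: divr_ge0 => //; apply: addr_ge0.
    by rewrite addr_ge0 ?expR_ge0.
  by rewrite divr_ge0 ?powR_ge0.
have xE : 0 < x `^ (eps / 2) by rewrite powR_gt0.
have xP : 0 < x `^ (1 + eps / 2) by rewrite powR_gt0.
have xD : x `^ (1 + eps) = x `^ (1 + eps / 2) * x `^ (eps / 2).
  by rewrite -powRD ?xn ?implybT //; congr (_ `^ _); field.
rewrite -mulrA.
apply: (@le_trans _ _ (2 * ((A ^+ 2 * x `^ (eps / 2)) *
   (32 * T * (1 + 2 / d ^+ 2) * (C / x `^ (1 + eps)))))).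
  apply: ler_wpM2l => //; apply: ler_pM => //; first exact: sqr_ge0.
    by apply: mulr_ge0 => //; apply: mulr_ge0; lra.
  by apply: ler_wpM2l => //; apply: mulr_ge0; lra.
rewrite xD le_eqVlt; apply/orP; left; apply/eqP; rewrite /G /M -/A.
move: (x `^ (eps / 2)) xE (x `^ (1 + eps / 2)) xP => u u0 v v0.
move: (2 / d ^+ 2) => z.
by field; rewrite !gt_eqF.
Qed.

(** By monotone convergence the series of the [g n] has a finite integral, so it is finite almost
    everywhere, and there its terms tend to [0]. *)
Lemma ae_cvg0_of_summable (R : realType) (D : set R) (g : nat -> R -> R)
    (beta : nat -> R) (B : R) :
  measurable D -> (forall n, measurable_fun D (g n)) ->
  (forall n t, D t -> 0 <= g n t) ->
  (forall n, (\int[@lebesgue_measure R]_(t in D) (g n t)%:E <= (beta n)%:E)%E) ->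
  (forall n, \sum_(k < n) beta k <= B) ->
  {ae @lebesgue_measure R, forall t, D t -> g n t @[n --> \oo] --> 0}.
Proof.
move=> mD mg g0 gb bB.
have mg' n : measurable_fun D (fun t => (g n t)%:E).
  by apply/measurable_EFinP; exact: mg.
have g0' n t : D t -> (0 <= (g n t)%:E)%E by move=> Dt; rewrite lee_fin g0.
have hint : (@lebesgue_measure R).-integrable D
    (fun t => \sum_(n <oo) (g n t)%:E)%E.
  apply/integrableP; split.
    apply: (@ge0_emeasurable_sum _ _ _ D (fun n t => (g n t)%:E) xpredT) => //.
    by move=> n t Dt _; exact: g0'.
  apply: (@le_lt_trans _ _ B%:E); last exact: ltry.
  have -> : (\int[@lebesgue_measure R]_(t in D) `|\sum_(n <oo) (g n t)%:E| =
      \int[@lebesgue_measure R]_(t in D) \sum_(n <oo) (g n t)%:E)%E.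
    apply: eq_integral => t; rewrite inE => Dt; rewrite gee0_abs //.
    by apply: nneseries_ge0 => n _ _; exact: g0'.
  rewrite integral_nneseries //.
  apply: lime_le.
    by apply: is_cvg_nneseries => n _ _; apply: integral_ge0 => t; exact: g0'.
  apply: nearW => n; apply: (@le_trans _ _ (\sum_(k < n) beta k)%:E).
    by rewrite big_mkord -sumEFin; apply: lee_sum.
  by rewrite lee_fin.
have hae := @integrable_ae _ _ _ (@lebesgue_measure R) D mD _ hint.
apply: (negligibleS _ hae) => t /= nt ht; apply: nt => Dt.
have {}ht := ht Dt.
apply: cvg_series_cvg_0; apply: nondecreasing_is_cvgn.
  by apply: nondecreasing_series => n _ _; exact: g0.
exists (fine (\sum_(n <oo) (g n t)%:E)%E) => _ [n _ <-].
rewrite -lee_fin fineK // /series /= -sumEFin.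
by apply: nneseries_lim_ge => k _ _; exact: g0'.
Qed.

Lemma ae_forall_nat (R : realType) (P : nat -> R -> Prop) :
  (forall n, {ae @lebesgue_measure R, forall t, P n t}) ->
  {ae @lebesgue_measure R, forall t, forall n, P n t}.
Proof.
move=> h; have := negligible_bigcup h.
apply: negligibleS => t /= /existsNP[n hn].
by exists n.
Qed.

(** * The null set of zeros and the passage to the decoherence factor *)

Lemma cos0_shift (R : realType) (x : R) (z : int) :
  cos x = 0 -> cos (x - z%:~R * pi) = 0.
Proof.
move=> cx; case: z => n.
  have : cos (x - n%:Z%:~R * pi + pi *+ n) = 0.
    by rewrite -pmulrn mulr_natl subrK.
  rewrite (alternatingn (@cosDpi R)) => /eqP.
  by rewrite mulf_eq0 signr_eq0 => /eqP.
have -> : x - (Negz n)%:~R * pi = x + pi *+ n.+1.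
  by rewrite NegzE mulrNz mulNr opprK -pmulrn mulr_natl.
by rewrite (alternatingn (@cosDpi R)) cx mulr0.
Qed.

Lemma countable_cos0 (R : realType) (a : R) :
  countable [set t : R | cos (a * t) = 0].
Proof.
have [->|a0] := eqVneq a 0.
  rewrite (_ : [set _ | _] = set0) //.
  by apply/seteqP; split => // t /=; rewrite mul0r cos0 => /eqP; rewrite oner_eq0.
apply: (@sub_countable _ _ _ (range (fun z : int => (z%:~R * pi - pi / 2) / a))).
  apply: subset_card_le => t /= ct.
  (* Reduction of [a t] modulo [pi] to [[- pi / 2, pi / 2)], where the only zero of the cosine is
     the left end. *)
  pose z := Num.floor ((a * t + pi / 2) / pi).
  have pi0 := @pi_gt0 R.
  pose y := a * t - z%:~R * pi.
  have /andP[y1 y2] : - (pi / 2) <= y < pi / 2.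
    have := floor_le ((a * t + pi / 2) / pi); rewrite -/z ler_pdivlMr // => h1.
    have := floorD1_gt ((a * t + pi / 2) / pi); rewrite -/z ltr_pdivrMr // => h2.
    have z1 : (z + 1)%:~R = z%:~R + 1 :> R by rewrite intrD.
    move: h2; rewrite z1 => h2.
    by apply/andP; split; rewrite /y; lra.
  have cy : cos y = 0 by exact: cos0_shift.
  exists z => //.
  have -> : z%:~R * pi - pi / 2 = a * t; last by rewrite mulrAC divff // mul1r.
  have yE : y = - (pi / 2).
    apply/eqP; rewrite eq_le y1 andbT leNgt; apply/negP => y3.
    by have := @cos_gt0_pihalf R y; rewrite y3 y2 cy ltxx => /(_ isT).
  by move: yE; rewrite /y; lra.
apply: (sub_countable (card_image_le _ _)).
exact: countableP.
Qed.

Lemma ln_norm_decoherence (R : realType) (e : nat -> R) (n : nat) (t : R) :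
  (forall k, cos (e k.+1 * t) != 0) ->
  ln `|decoherence e n t| = \sum_(i < n) ln `|cos (e i.+1 * t)|.
Proof.
move=> ct; rewrite /decoherence big_add1 big_mkord.
(* Positivity of the product is carried through the induction because [lnM] requires it. *)
have [] : 0 < `|\prod_(i < n) cos (e i.+1 * t)| /\
  ln `|\prod_(i < n) cos (e i.+1 * t)| = \sum_(i < n) ln `|cos (e i.+1 * t)|;
  last by [].
elim: n => [|n [IH0 IH]]; first by rewrite !big_ord0 normr1 ln1.
have c0 : 0 < `|cos (e n.+1 * t)| by rewrite normr_gt0.
rewrite !big_ord_recr /= normrM; split; first by rewrite mulr_gt0.
by rewrite lnM ?posrE // IH.
Qed.

Lemma cvg0_of_weighted_sqr (R : realType) (w : R) (u : nat -> R) : 0 < w ->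
  w * u n ^+ 2 @[n --> \oo] --> 0 -> u n @[n --> \oo] --> 0.
Proof.
move=> w0 h; apply/cvgrPdist_lt => eps eps0.
have d0 : 0 < w * eps ^+ 2 by apply: mulr_gt0 => //; exact: exprn_gt0.
move/cvgrPdist_lt : h => /(_ _ d0); apply: filterS => n.
rewrite !sub0r !normrN => h.
rewrite -(@ltr_pXn2r _ 2) ?nnegrE ?(ltW eps0) // real_normK ?num_real //.
rewrite -(ltr_pM2l w0); apply: le_lt_trans h; exact: ler_norm.
Qed.

Lemma countable_cos_zeros (R : realType) (e : nat -> R) :
  countable [set t : R | exists n, cos (e n.+1 * t) = 0].
Proof.
rewrite (_ : [set _ | _] = \bigcup_n [set t : R | cos (e n.+1 * t) = 0]).
  by apply: bigcup_countable => // n _; exact: countable_cos0.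
by apply/seteqP; split => t [n]; [exists n | move=> _ ?; exists n].
Qed.

(** The zeros are removed from [[-T, T]] to form [D]. The strict bound on [|t|] keeps the weight
    positive, so it can be divided out of the weighted limit. *)
Lemma ae_block_mean_cvg0 (R : realType) (e : nat -> R) (p q : nat) :
  weyl_growth e ->
  {ae @lebesgue_measure R, forall t : R, `|t| < q.+1%:R ->
    (forall n, cos (e n.+1 * t) != 0) ->
    log2cos_mean e (block p k) t @[k --> \oo] --> 0}.
Proof.
move=> we; set T : R := q.+1%:R.
have T1 : 1 <= T by rewrite ler1n.
have T0 : 0 < T by rewrite ltr0n.
pose Z := [set t : R | exists n, cos (e n.+1 * t) = 0].
pose D := `[- T, T]%classic `\` Z.
have mD : measurable D.
  apply: measurableD => //; apply: countable_measurable => //.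
  exact: countable_cos_zeros.
have DT : D `<=` `[- T, T]%classic by move=> t [].
have cD n t : (0 < n)%N -> D t -> cos (e n * t) != 0.
  case: n => // n _ [_ Zt]; apply/eqP => c0; apply: Zt; by exists n.
have [beta [B [hb hB]]] := block_mean_L2_summable p we T1 mD DT cD.
have mg k : measurable_fun D
    (fun t => weight T t * log2cos_mean e (block p k) t ^+ 2).
  apply: measurable_funM; first exact: measurable_weight.
  by apply: measurable_funX; exact: measurable_log2cos_mean.
have g0 k t : D t -> 0 <= weight T t * log2cos_mean e (block p k) t ^+ 2.
  move=> [tT _]; apply: mulr_ge0; last exact: sqr_ge0.
  by have /andP[] := weight_bounds T0 tT.
have hae := ae_cvg0_of_summable mD mg g0 hb hB.
apply: (negligibleS _ hae) => t /= nt ht; apply: nt => tT ct.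
apply: (@cvg0_of_weighted_sqr _ (weight T t)); first exact: weight_gt0.
apply: ht; split; first by rewrite /= in_itv /= -ler_norml ltW.
by move=> [n c0]; have := ct n; rewrite c0 eqxx.
Qed.

Theorem theorem5 (R : realType) (e : nat -> R) :
  weyl_growth e ->
  {ae (@lebesgue_measure R), forall t : R,
     (fun n : nat => n%:R^-1 * ln `|decoherence e n t|) @ \oo --> - ln (2 : R)}.
Proof.
move=> we.
(* Countably many exceptional sets: one for each interval radius [q + 1] and each block ratio
   [p]. *)
have h1 := ae_forall_nat (fun q => ae_forall_nat
  (fun p => ae_block_mean_cvg0 p q we)).
have h2 : (@lebesgue_measure R).-negligible
    [set t : R | exists n, cos (e n.+1 * t) = 0].
  have hc := countable_cos_zeros e.
  apply/negligibleP; first exact: countable_measurable.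
  exact: countable_lebesgue_measure0.
apply: (negligibleS _ (negligibleU h1 h2)) => t /= nt.
have [[n cn]|nc] := pselect (exists n, cos (e n.+1 * t) = 0).
  by right; exists n.
left => ht; apply: nt.
have ct n : cos (e n.+1 * t) != 0.
  by apply/eqP => c0; apply: nc; exists n.
have l2 : 0 <= ln (2 : R) by rewrite ln_ge0 // ler1n.
(* The upper bound [ln 2] on the terms comes from [|cos| <= 1]; the radius for this [t] is the
   integer part of [|t|] plus one. *)
have hm : log2cos_mean e n t @[n --> \oo] --> 0.
  apply: (@mean_cvg0_of_blocks _ (fun i => ln `|cos (e i.+1 * t)| + ln 2) (ln 2)) => //.
    by move=> n; rewrite gerDr ln_le0 // cos_max.
  by move=> p; apply: (ht (Num.truncn `|t|)) => //; exact: truncnS_gt.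
have hs : log2cos_mean e n t - ln 2 @[n --> \oo] --> - ln 2.
  by rewrite -[X in _ --> X]sub0r; apply: cvgB => //; exact: cvg_cst.
apply: cvg_trans hs; apply: near_eq_cvg.
near=> n.
have n0 : (0 < n)%N by near: n; exact: nbhs_infty_gt.
rewrite ln_norm_decoherence // /log2cos_mean big_split /= mulrDr.
rewrite sumr_const card_ord -[ln 2 *+ n]mulr_natl mulrA mulVf ?mul1r ?addrK //.
by rewrite pnatr_eq0 -lt0n.
Unshelve. all: by end_near. Qed.
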